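(* The coefficients of the generalized $q$-Catalan numbers $$C_{n,m}(q)=\frac{1}{[(m-1)n+1]}{mn\brack n}$$ are normally distributed when $n\to\infty$.
   Context: Notation: $[n]=1+q+q^2+\cdots+q^{n-1}$, $[n]!=[1][2]\cdots[n]$, and ${n\brack k}=\frac{[n]!}{[k]!\,[n-k]!}$. The polynomial $C_{n,m}(q)$ is the $q$-analog of the $m$-Catalan number $C_{n,m}=\frac{1}{(m-1)n+1}\binom{mn}{n}$, defined for $n\ge 1$. Writing $C_{n,m}(q)=\sum_k p_n(k)q^k$, let $\xi_n$ be the random variable with $P(\xi_n=k)=p_n(k)/\sum_j p_n(j)$. ''The coefficients are normally distributed when $n\to\infty$'' means that the standardized variable $(\xi_n-E(\xi_n))/\operatorname{Var}(\xi_n)^{1/2}$ has the standard normal distribution in the limit $n\to\infty$ (convergence in distribution). *)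

(* Defs.v *)
From HB Require Import structures.
From mathcomp Require Import all_boot all_order all_algebra.
From mathcomp Require Import all_classical all_reals all_analysis.
Import Order.TTheory GRing.Theory Num.Theory.
Import numFieldNormedType.Exports.

Set Implicit Arguments.
Unset Strict Implicit.
Unset Printing Implicit Defensive.

Local Open Scope classical_set_scope.
Local Open Scope ring_scope.

Section QAnalogs.
Variable F : fieldType.

Definition qint (n : nat) : {poly F} := \sum_(i < n) 'X^i.

Definition qfact (n : nat) : {poly F} := \prod_(1 <= i < n.+1) qint i.

(* The quotients [%/] below are Euclidean quotients in {poly F}; they are exact
   by [qbinE] (for k <= n) and [qCatalanE] (for m >= 1). *)
Definition qbin (n k : nat) : {poly F} :=
  qfact n %/ (qfact k * qfact (n - k)).

Definition qCatalan (n m : nat) : {poly F} :=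
  qbin (m * n) n %/ qint ((m - 1) * n + 1).

Lemma qintS n : qint n.+1 = qint n + 'X^n.
Proof. by rewrite /qint big_ord_recr. Qed.

Lemma qintD a b : qint (a + b) = qint a + 'X^a * qint b.
Proof.
elim: b => [|b IH]; first by rewrite addn0 {3}/qint big_ord0 mulr0 addr0.
by rewrite addnS !qintS IH exprD mulrDr addrA.
Qed.

Lemma qint_neq0 n : qint n.+1 != 0.
Proof.
apply/eqP => /(congr1 (fun p : {poly F} => p`_n)).
rewrite qintS coefD coefXn eqxx coef0 /qint coef_sum big1 => [|i _].
  by rewrite add0r => /eqP; rewrite oner_eq0.
by rewrite coefXn gtn_eqF.
Qed.

Lemma qfact0 : qfact 0 = 1.
Proof. by rewrite /qfact big_geq. Qed.

Lemma qfactS n : qfact n.+1 = qfact n * qint n.+1.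
Proof. by rewrite /qfact big_nat_recr. Qed.

Lemma qfact_neq0 n : qfact n != 0.
Proof.
elim: n => [|n IH]; first by rewrite qfact0 oner_neq0.
by rewrite qfactS mulf_neq0 ?qint_neq0.
Qed.

Lemma qfact_dvdp a b : (qfact a * qfact b) %| qfact (a + b).
Proof.
have [n] := ubnP (a + b); elim: n a b => // n IH [|a] [|b];
  rewrite ?addn0 ?add0n ?qfact0 ?mulr1 ?mul1r ?dvdpp // => lt_n.
have -> : qfact (a.+1 + b.+1) =
    qfact (a + b.+1) * qint a.+1 + 'X^(a.+1) * (qfact (a.+1 + b) * qint b.+1).
  rewrite {1}addSn qfactS -addSn qintD mulrDr -addSnnS; congr (_ + _).
  by rewrite mulrCA.
rewrite dvdp_add //.
  by rewrite [qfact a.+1]qfactS mulrAC dvdp_mul ?dvdpp ?IH.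
rewrite [qfact b.+1]qfactS mulrA dvdp_mull // dvdp_mul ?dvdpp // IH //.
by rewrite addSnnS.
Qed.

Lemma qbinE n k : (k <= n)%N ->
  qbin n k * (qfact k * qfact (n - k)) = qfact n.
Proof. by move=> kn; rewrite divpK // -{2}(subnKC kn) qfact_dvdp. Qed.

Lemma qint_dvdp a u : qint a %| qint (u * a).
Proof.
elim: u => [|u IH]; first by rewrite mul0n /qint [X in _ %| X]big_ord0 dvdp0.
by rewrite mulSn qintD dvdp_add ?dvdpp // dvdp_mull.
Qed.

Lemma qint_coprimep a b : (0 < a)%N -> coprime a b ->
  coprimep (qint a) (qint b).
Proof.
move=> a0 /eqP cab; apply/coprimepP => e ea eb.
have [u v uv _] := egcdnP b a0.
rewrite -size_poly_eq1 -dvdp1.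
have -> : 1 = qint (u * a) - 'X * qint (v * b).
  rewrite uv cab addnC qintD /qint [X in _ = X + _ - _]big_ord_recl big_ord0.
  by rewrite /= expr0 addr0 expr1 addrK.
apply: dvdp_sub; first by apply: dvdp_trans ea (qint_dvdp _ _).
by apply: dvdp_mull; apply: dvdp_trans eb (qint_dvdp _ _).
Qed.

Lemma qCatalanE n m : (0 < m)%N ->
  qCatalan n m * qint ((m - 1) * n + 1) = qbin (m * n) n.
Proof.
case: m => // m _; rewrite divpK // subn1 /= addn1.
case: n => [|n].
  have -> : qint (m * 0).+1 = 1 by rewrite muln0 /qint big_ord_recl big_ord0 addr0.
  by rewrite dvd1p.
set N := (m * n.+1)%N.
have E : qbin (m.+1 * n.+1) n.+1 * qint n.+1
         = qbin (m.+1 * n.+1) n * qint N.+1.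
  have kn : (n.+1 <= m.+1 * n.+1)%N by rewrite mulSn leq_addr.
  have h1 := qbinE kn; have h2 := qbinE (ltnW kn).
  have e1 : (m.+1 * n.+1 - n.+1 = N)%N by rewrite mulSn addKn.
  have e2 : (m.+1 * n.+1 - n = N.+1)%N by rewrite mulSn addSnnS addKn.
  rewrite e1 in h1; rewrite e2 in h2.
  apply: (mulIf (mulf_neq0 (qfact_neq0 n) (qfact_neq0 N))).
  transitivity (qfact (m.+1 * n.+1)).
    by rewrite -h1 qfactS -!mulrA; congr (_ * _); rewrite mulrCA.
  rewrite -h2 [qfact N.+1]qfactS -!mulrA; congr (_ * _).
  by rewrite [RHS]mulrC mulrA.
rewrite -(@Gauss_dvdpl _ _ (qint n.+1)).
  by rewrite E dvdp_mull ?dvdpp.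
apply: qint_coprimep => //.
by rewrite /N -addn1 coprime_sym /coprime gcdnMDl gcdn1.
Qed.
End QAnalogs.

Section Standardization.
Context (d : measure_display) (T : measurableType d) (R : realType).
Variable P : probability T R.

Definition standardize (X : {RV P >-> R}) (w : T) : R :=
  (X w - fine 'E_P[X]) / Num.sqrt (fine 'V_P[X]).

Lemma measurable_standardize (X : {RV P >-> R}) :
  measurable_fun [set: T] (standardize X).
Proof.
by apply: measurable_realfun.measurable_funM => //;
  apply: measurable_realfun.measurable_funB.
Qed.

HB.instance Definition _ (X : {RV P >-> R}) :=
  isMeasurableFun.Build _ _ _ _ (standardize X) (measurable_standardize X).
End Standardization.

(* Convergence in distribution to the law mu; the X n may live on different
   probability spaces. *)
Definition cvg_in_distribution (R : realType) (d : nat -> measure_display)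
    (T : forall n, measurableType (d n)) (P : forall n, probability (T n) R)
    (X : forall n, {RV (P n) >-> R}) (mu : probability (measurableTypeR R) R) : Prop :=
  forall x : R, {for x, continuous (fun t : R => mu `]-oo, t]%classic)} ->
    cdf (X n) x @[n --> \oo] --> mu `]-oo, x]%classic.
Arguments cvg_in_distribution {R d T} P X mu.

(* Main.v *)
(** [C_{n,m}(q)] times the product of the [[j]] with [2 <= j <= n] is the
    product of the [[(m-1)n+j]].  Evaluating at [q = exp(it)], a factor [[k]] has
    modulus [sin (kt/2) / sin (t/2)] and a phase linear in [t], so the characteristic
    function of the centered variable is a product of quotients of [sin x / x].  Since
    [sin x / x = exp (- x^2/6 + O(x^4))] and the variance is of order [n^3], the
    standardized characteristic function at [u] is [exp (- u^2/2 + O(1/n))].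
    The conclusion follows by a continuity theorem for tight sequences: on [[-A, A]]
    the step function is approximated by a trigonometric polynomial of period much
    larger than [A] with values in [[0, 1]], and what happens outside [[-A, A]] is
    controlled by tightness, here Chebyshev's inequality. *)

From HB Require Import structures.
Require Import Defs.
From mathcomp Require Import all_boot all_order all_algebra.
From mathcomp Require Import all_classical all_reals all_analysis.
From mathcomp Require Import measurable_realfun.
From mathcomp Require Import ring lra.
Import Order.TTheory GRing.Theory Num.Theory.
Import numFieldNormedType.Exports.

Set Implicit Arguments.
Unset Strict Implicit.
Unset Printing Implicit Defensive.

Local Open Scope classical_set_scope.
Local Open Scope ring_scope.

(** * The characteristic function of the normal law *)

Section GaussianCharacteristicFunction.
Context {R : realType}.
Local Notation mu := (@lebesgue_measure R).
Local Notation w := (@normal_pdf R 0 1).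

(** The change of variables puts the Radon-Nikodym derivative in place of [w]; the two agree almost
    everywhere because they have the same integral over every measurable set. *)
Lemma normal_prob_integral (f : R -> R) :
  (normal_prob 0 1).-integrable setT (EFin \o f) ->
  \int[normal_prob (0:R) 1]_x f x = \int[mu]_x (f x * w x).
Proof.
move=> intf; have dom := @normal_prob_dominates R 0 1.
congr fine; under [RHS]eq_integral do rewrite EFinM.
rewrite -(Radon_Nikodym_change_of_variables dom)//=.
apply: ae_eq_integral => //.
- apply: emeasurable_funM; first exact: (measurable_int _ intf).
  by apply: (measurable_int mu); apply: Radon_Nikodym_integrable.
- apply: emeasurable_funM; first exact: (measurable_int _ intf).
  by apply/measurable_EFinP; exact: measurable_normal_pdf.
- apply: ae_eqe_mul2l => /=.
  rewrite Radon_NikodymE//=.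
  case: cid => /= h [h1 h2 h3].
  apply: integral_ae_eq => //=.
  + by apply/measurable_EFinP; exact: measurable_normal_pdf.
  + by move=> E _ mE; rewrite -h3.
Qed.

Lemma normal_pdf01E (x : R) : w x = w 0 * expR (- (x ^+ 2 / 2)).
Proof.
rewrite normal_pdfE ?oner_eq0// /normal_fun !subr0 expr1n mulr2n -[1 + 1]/2.
by rewrite expr0n/= oppr0 mul0r expR0 mulr1 mulNr.
Qed.

(** An instance, so that type class search differentiates products with the density. *)
Global Instance is_derive_normal_pdf01 (x : R) : is_derive x 1 w (- x * w x).
Proof.
rewrite (_ : w = (fun x => w 0 * expR (- (x ^+ 2 / 2)))); last first.
  by apply/funext => y; exact: normal_pdf01E.
apply: is_derive_eq; rewrite /GRing.scale/=.
by set e := expR _; field.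
Qed.

Lemma le_normr_mul_bounded (b y M : R) : `|b| <= M -> `|b * w y| <= `|M * w y|.
Proof.
move=> bM; rewrite !normrM ler_wpM2r// (le_trans bM)//; exact: ler_norm.
Qed.

Lemma integrable_bounded_normal_pdf (f : R -> R) (M : R) :
  measurable_fun setT f -> (forall y, `|f y| <= M) ->
  mu.-integrable setT (EFin \o (fun y => f y * w y)).
Proof.
move=> mf fM.
apply: (@le_integrable _ _ _ mu setT measurableT _ (fun y => (M * w y)%:E)) => //=.
- apply/measurable_EFinP; apply: measurable_funM => //.
  exact: measurable_normal_pdf.
- by move=> y _; rewrite lee_fin le_normr_mul_bounded.
- under eq_fun do rewrite EFinM.
  by apply: integrableZl => //; exact: integrable_normal_pdf.
Qed.

(** Since exp(y^2/4) >= 1 + y^2/4 >= |y|, one factor exp(-y^2/4) absorbs [|y|]; the other is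
    proportional to the normal density of variance 2, an integrable dominating function. *)
Lemma normr_mul_normal_pdf01_le (y : R) :
  `|y| * w y <= w 0 / normal_peak (Num.sqrt 2) * normal_pdf 0 (Num.sqrt 2) y.
Proof.
have s2 : Num.sqrt 2 != 0 :> R by rewrite gt_eqF// sqrtr_gt0.
have w0 : 0 < w 0 :> R.
  rewrite normal_pdfE ?oner_eq0// mulr_gt0 ?expR_gt0//.
  by rewrite normal_peak_gt0 ?oner_eq0.
rewrite (normal_pdfE _ s2) mulrA divfK ?gt_eqF ?normal_peak_gt0//.
rewrite normal_pdf01E mulrCA ler_pM2l// /normal_fun subr0 sqr_sqrtr//.
have -> : - (y ^+ 2 / 2) = - (y ^+ 2 / 4) + - (y ^+ 2 / 4) by field.
have -> : - y ^+ 2 / (2 *+ 2) = - (y ^+ 2 / 4) by rewrite -mulr_natr; field.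
rewrite expRD mulrA ler_piMl ?expR_ge0// expRN ler_pdivrMr ?expR_gt0// mul1r.
rewrite (le_trans _ (expR_ge1Dx _))// -(real_normK (num_real y)).
by have := sqr_ge0 (`|y| - 2); rewrite sqrrB; set z := `|y|; lra.
Qed.

(** Fundamental theorem of calculus on growing symmetric intervals, then dominated convergence with
    bound [|f|]. *)
Lemma integral_derivative_eq0 (f F : R -> R) :
  continuous f -> (forall x, is_derive x (1:R) F (f x)) ->
  mu.-integrable setT (EFin \o f) ->
  F n%:R @[n --> \oo] --> 0 -> F (- n%:R) @[n --> \oo] --> 0 ->
  \int[mu]_x f x = 0.
Proof.
move=> cf dF intf Fp Fn.
(* The index [n.+1] keeps the interval nondegenerate at n = 0. *)
pose A n : set R := [set` `[- n.+1%:R, n.+1%:R]%R].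
have mf : measurable_fun setT (EFin \o f) by exact: measurable_int intf.
have cF : continuous F.
  by move=> x; apply/differentiable_continuous/derivable1_diffP; exact: ex_derive.
have iA n : (\int[mu]_x ((EFin \o f) \_ (A n)) x)%E
    = (F n.+1%:R - F (- n.+1%:R))%:E.
  rewrite -integral_mkcond; apply: continuous_FTC2.
  - by rewrite ltrNl (lt_trans _ (ltr0Sn _ _))// oppr_lt0.
  - exact: continuous_subspaceT.
  - split.
    + by move=> x _; exact: ex_derive.
    + by apply: cvg_at_right_filter; exact: cF.
    + by apply: cvg_at_left_filter; exact: cF.
  - by move=> x _; rewrite derive1E; exact: derive_val.
have mA n : measurable (A n) by exact: measurable_itv.
have cvgA : {ae mu, forall x, [set: R] x ->
    ((EFin \o f) \_ (A n)) x @[n --> \oo] --> (EFin \o f) x}.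
  apply/aeW => x _; apply: cvg_near_cst; near=> n.
  rewrite patchE mem_set// /A/= in_itv/= -ler_norml.
  near: n; exists (Num.truncn `|x|) => // n /= xn.
  rewrite (le_trans (ltW (truncnS_gt _)))// ler_nat ltnS//.
have mfA n : measurable_fun setT ((EFin \o f) \_ (A n)).
  apply/(measurable_restrictT _ (mA n)).
  exact: measurable_funS mf.
have fA : {ae mu, forall x n, [set: R] x ->
    (`|((EFin \o f) \_ (A n)) x| <= (abse \o (EFin \o f)) x)%E}.
  apply/aeW => x n _; rewrite patchE; case: ifP => _ //=.
  by rewrite lee_fin normr0.
have [_ _ dc] := @dominated_convergence _ _ R mu setT measurableT _ _ _ mfA mf cvgA
  (integrable_abse intf) fA.
have /fine_cvg cvgF : (F n.+1%:R - F (- n.+1%:R))%:E @[n --> \oo] -->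
    (\int[mu]_x f x)%:E.
  by rewrite /Rintegral fineK ?integrable_fin_num// -(eq_cvg _ _ iA).
rewrite -(cvg_lim _ cvgF)//; apply/cvg_lim => //.
rewrite -[X in _ --> X](subrr 0); apply: cvgB.
- by rewrite (cvg_shiftS (fun n => F n%:R)).
- by rewrite (cvg_shiftS (fun n => F (- n%:R))).
Unshelve. all: by end_near. Qed.


(** A crude rate, enough for boundary terms: at [|y| = n] it is a multiple of [harmonic n]. *)
Lemma normal_pdf01_decay (y : R) : w y <= w 0 * 2 / (1 + `|y|).
Proof.
have w0 : 0 <= w 0 :> R by exact: normal_pdf_ge0.
have y1 : 0 < 1 + `|y| by rewrite ltr_pwDl.
rewrite normal_pdf01E -mulrA ler_wpM2l// expRN.
rewrite ler_pdivlMr// ler_pdivrMl ?expR_gt0//.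
have := expR_ge1Dx (y ^+ 2 / 2); rewrite -(real_normK (num_real y)).
have := normr_ge0 y; have := sqr_ge0 (`|y| - 1); rewrite sqrrB expr1n mulr1.
by set z := `|y|; set e := expR _; lra.
Qed.

Lemma cvg_mul_normal_pdf01 (b s : nat -> R) :
  (forall n, `|b n| <= 1) -> (forall n, `|s n| = n%:R) ->
  b n * w (s n) @[n --> \oo] --> 0.
Proof.
move=> b1 sn; apply/norm_cvg0P.
have : w 0 * 2 * harmonic n @[n --> \oo] --> (0 : R).
  by rewrite -[X in _ --> X](mulr0 (w 0 * 2)); apply: cvgM; [exact: cvg_cst|exact: cvg_harmonic].
apply: squeeze_cvgr (cvg_cst 0); apply: nearW => n.
rewrite normr_ge0 normrM (ger0_norm (normal_pdf_ge0 _ _ _))/=.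
rewrite (le_trans (ler_piMl _ (b1 n))) ?normal_pdf_ge0//.
by rewrite (le_trans (normal_pdf01_decay _))// sn -[n.+1]add1n natrD.
Qed.

Lemma integrable_sin_normal_pdf01 (u v : R) :
  mu.-integrable setT (EFin \o (fun y => y * sin (u * y + v) * w y)).
Proof.
have ms : measurable_fun setT (fun y : R => sin (u * y + v)).
  apply: continuous_measurable_fun => y; apply: continuous_comp; last exact: continuous_sin.
  by apply: cvgD; [apply: cvgM => //; exact: cvg_cst|exact: cvg_cst].
apply: (@le_integrable _ _ _ mu setT measurableT _
  (fun y => (w 0 / normal_peak (Num.sqrt 2) * normal_pdf 0 (Num.sqrt 2) y)%:E)) => //=.
- apply/measurable_EFinP; apply: measurable_funM; last exact: measurable_normal_pdf.
  exact: measurable_funM.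
- move=> y _; rewrite lee_fin (le_trans _ (ler_norm _))//.
  apply: le_trans (normr_mul_normal_pdf01_le y).
  rewrite normrM (ger0_norm (normal_pdf_ge0 _ _ _)) ler_wpM2r ?normal_pdf_ge0//.
  by rewrite normrM ler_piMr// sin_max.
- under eq_fun do rewrite EFinM.
  by apply: integrableZl => //; exact: integrable_normal_pdf.
Qed.

(** Integration by parts: the right integrand minus the left one is the derivative of sin(u y + v)
    w(y), which vanishes at both ends. *)
Lemma integral_sin_normal_pdf01 (u v : R) :
  \int[mu]_y (y * sin (u * y + v) * w y) = u * \int[mu]_y (cos (u * y + v) * w y).
Proof.
have mc : measurable_fun setT (fun y : R => cos (u * y + v)).
  apply: continuous_measurable_fun => y; apply: continuous_comp; last exact: continuous_cos.
  by apply: cvgD; [apply: cvgM => //; exact: cvg_cst|exact: cvg_cst].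
have ic : mu.-integrable setT (EFin \o (fun y => cos (u * y + v) * w y)).
  by apply: (@integrable_bounded_normal_pdf _ 1) => // y; exact: cos_max.
have is_ := integrable_sin_normal_pdf01 u v.
apply/esym/eqP; rewrite -subr_eq0 -RintegralZl// -RintegralB//; last first.
  exact: (integrableZl measurableT u ic).
apply/eqP; apply: (@integral_derivative_eq0 _ (fun y => sin (u * y + v) * w y)).
- have cc : continuous (fun y : R => u * y + v).
    by move=> y; apply: cvgD; [apply: cvgM => //; exact: cvg_cst|exact: cvg_cst].
  have cw := @continuous_normal_pdf R 0 1 (oner_neq0 _).
  move=> y; apply: cvgB.
    apply: cvgM; first exact: cvg_cst.
    apply: cvgM; last exact: cw.
    by apply: continuous_comp; [exact: cc|exact: continuous_cos].
  apply: cvgM; last exact: cw.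
  apply: cvgM; first exact: cvg_id.
  by apply: continuous_comp; [exact: cc|exact: continuous_sin].
- move=> x; eapply trigger_derive; first by typeclasses eauto.
  by rewrite /GRing.scale/=; ring.
- rewrite /comp; under eq_fun do rewrite EFinB.
  by apply: integrableB => //; exact: (integrableZl measurableT u ic).
- apply: cvg_mul_normal_pdf01 => n; [exact: sin_max|by rewrite normr_nat].
- apply: cvg_mul_normal_pdf01 => n; [exact: sin_max|by rewrite normrN normr_nat].
Qed.

(** As a function of the frequency, the integral solves G' = - u G. The free phase [v] encodes real
    and imaginary parts at once, so only real cosines occur. *)
Lemma normal_prob_cos (u v : R) :
  \int[normal_prob (0:R) 1]_y cos (u * y + v) = expR (- (u ^+ 2 / 2)) * cos v.
Proof.
have mc u' : measurable_fun setT (fun y : R => cos (u' * y + v)).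
  apply: continuous_measurable_fun => y; apply: continuous_comp; last exact: continuous_cos.
  by apply: cvgD; [apply: cvgM => //; exact: cvg_cst|exact: cvg_cst].
rewrite normal_prob_integral; last first.
  apply: measurable_bounded_integrable => //.
  - by rewrite ltey_eq fin_num_measure.
  - exact: mc.
  - by exists 1; split => // M M1 y _ /=; rewrite (le_trans (cos_max _))// ltW.
pose G u := \int[mu]_y (cos (u * y + v) * w y).
have dG x : is_derive x (1:R) G (- x * G x).
  have d y z : is_derive z (1:R) (fun u' => cos (u' * y + v) * w y) (- (y * sin (z * y + v) * w y)).
    eapply trigger_derive; first by typeclasses eauto.
    by rewrite /GRing.scale/=; ring.
  have I x' : `]x - 1, x + 1[%classic x' ->
      mu.-integrable setT (EFin \o (fun y => cos (x' * y + v) * w y)).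
    by move=> _; apply: (@integrable_bounded_normal_pdf _ 1) => // y; exact: cos_max.
  have Ix : `]x - 1, x + 1[%classic x by rewrite /= in_itv/= ltrBlDr ltrDl ltr01.
  (* Differentiating in the frequency brings down a factor y; [H] dominates the result uniformly in
     the frequency. *)
  pose H y := w 0 / normal_peak (Num.sqrt 2) * normal_pdf 0 (Num.sqrt 2) y.
  have H0 y : 0 <= H y.
    by rewrite !mulr_ge0// ?normal_pdf_ge0// invr_ge0 normal_peak_ge0.
  have iH : mu.-integrable setT (EFin \o H).
    rewrite /comp/=; under eq_fun do rewrite EFinM.
    by apply: integrableZl => //; exact: integrable_normal_pdf.
  have dE u' y : partial1of2 (fun x y => cos (x * y + v) * w y) u' y =
      - (y * sin (u' * y + v) * w y).
    by rewrite partial1of2E; exact: derive_val.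
  have Hub x' y : `]x - 1, x + 1[%classic x' -> [set: R] y ->
      `|partial1of2 (fun x y => cos (x * y + v) * w y) x' y| <= H y.
    move=> _ _; rewrite dE normrN; apply: le_trans (normr_mul_normal_pdf01_le y).
    rewrite normrM (ger0_norm (normal_pdf_ge0 _ _ _)) ler_wpM2r ?normal_pdf_ge0//.
    by rewrite normrM ler_piMr// sin_max.
  have df x' y : `]x - 1, x + 1[%classic x' -> [set: R] y ->
      derivable (fun z : R => cos (z * y + v) * w y) x' (1 : R).
    by move=> _ _; exact: ex_derive.
  split; first exact: (derivable_under_integral measurableT Ix I df H0 iH Hub).
  rewrite -derive1E (differentiation_under_integral measurableT Ix I df H0 iH Hub).
  under eq_Rintegral do rewrite dE -mulN1r.
  rewrite RintegralZl//; last exact: integrable_sin_normal_pdf01.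
  by rewrite integral_sin_normal_pdf01 mulN1r mulNr.
(* By [dG] this product has zero derivative; at 0 it is cos v times the total mass 1. *)
have : expR (u ^+ 2 / 2) * G u = expR (0 ^+ 2 / 2) * G 0.
  apply: (@is_derive_0_is_cst _ (fun x => expR (x ^+ 2 / 2) * G x)) => z.
  eapply trigger_derive; first by typeclasses eauto.
  by rewrite /GRing.scale/=; set e := expR _; field.
rewrite expr0n/= mul0r expR0 mul1r {2}/G.
under eq_Rintegral do rewrite mul0r add0r.
rewrite RintegralZl//; last exact: integrable_normal_pdf.
rewrite /Rintegral integral_normal_pdf/= mulr1 => <-.
by rewrite expRN mulKf// gt_eqF// expR_gt0.
Qed.

End GaussianCharacteristicFunction.

(** * Continuity theorem for tight sequences *)

Section TrigonometricPolynomials.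
Context {R : realType}.
Implicit Types (f g : R -> R) (a u v x y : R).

(** The phase covers sines and frequency 0 covers constants, so a limit known for cosines extends by
    linearity to the whole class. *)
Inductive trig_poly : (R -> R) -> Prop :=
| TrigCos a u v : trig_poly (fun y => a * cos (u * y + v))
| TrigAdd f g : trig_poly f -> trig_poly g -> trig_poly (fun y => f y + g y).

Lemma trig_polyM f g : trig_poly f -> trig_poly g -> trig_poly (fun y => f y * g y).
Proof.
move=> tf tg; elim: tf g tg => [a u v|f1 f2 _ IH1 _ IH2] g tg; last first.
  under eq_fun do rewrite mulrDl.
  by apply: TrigAdd; [exact: IH1|exact: IH2].
elim: tg => [b s t|g1 g2 _ IH1 _ IH2]; last first.
  under eq_fun do rewrite mulrDr.
  exact: TrigAdd.
rewrite (_ : (fun _ => _) = (fun y =>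
    a * b / 2 * cos ((u + s) * y + (v + t)) +
    a * b / 2 * cos ((u - s) * y + (v - t)))); first exact: TrigAdd (TrigCos _ _ _) (TrigCos _ _ _).
apply/funext => y.
have -> : (u + s) * y + (v + t) = (u * y + v) + (s * y + t) by ring.
have -> : (u - s) * y + (v - t) = (u * y + v) - (s * y + t) by ring.
by move: (u * y + v) (s * y + t) => p q; rewrite cosD cosB; field.
Qed.

Lemma trig_poly_cst a : trig_poly (fun=> a).
Proof.
rewrite (_ : (fun=> a) = (fun y => a * cos (0 * y + 0))); first exact: TrigCos.
by apply/funext => y; rewrite mul0r addr0 cos0 mulr1.
Qed.

(* Fixes 0, 1/2 and 1, is symmetric about 1/2 and attracts [0, 1/2[ to 0, so its
   iterates approximate a step function. *)
Definition smoothstep x : R := 3 * x ^+ 2 - 2 * x ^+ 3.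

Lemma trig_poly_smoothstep f : trig_poly f -> trig_poly (fun y => smoothstep (f y)).
Proof.
move=> tf; rewrite (_ : (fun _ => _) =
    (fun y => f y * f y * (3 + (- 2) * f y))); last first.
  by apply/funext => y; rewrite /smoothstep; ring.
by do ?[apply: trig_polyM => // | apply: TrigAdd | exact: trig_poly_cst].
Qed.

Lemma trig_poly_iter_smoothstep k f : trig_poly f ->
  trig_poly (fun y => iter k smoothstep (f y)).
Proof. by move=> tf; elim: k => [//|k IH] /=; exact: trig_poly_smoothstep. Qed.

Lemma smoothstep01 x : 0 <= x <= 1 -> 0 <= smoothstep x <= 1.
Proof. move=> /andP[x0 x1].
rewrite -[smoothstep x <= 1]subr_ge0 (_ : smoothstep x = x ^+ 2 * (3 - 2 * x)).
  rewrite (_ : 1 - _ = (1 - x) ^+ 2 * (1 + 2 * x)); last by ring.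
  by rewrite !mulr_ge0 ?sqr_ge0//; lra.
by rewrite /smoothstep; ring. Qed.

Lemma iter_smoothstep01 k x : 0 <= x <= 1 -> 0 <= iter k smoothstep x <= 1.
Proof. by move=> x01; elim: k => //= k; exact: smoothstep01. Qed.

Lemma iter_smoothstepC k x : iter k smoothstep (1 - x) = 1 - iter k smoothstep x.
Proof. by elim: k => //= k ->; rewrite /smoothstep; ring. Qed.

(** One step multiplies z by z (3 - 2 z), which increases on [0, 1/2] and equals 1 at 1/2; on [0, e]
    this factor is at most q < 1, so the decay is geometric. *)
Lemma iter_smoothstep_le k e x : 0 <= e < 2^-1 -> 0 <= x <= e ->
  0 <= iter k smoothstep x <= (e * (3 - 2 * e)) ^+ k * e.
Proof.
move=> e12 xe; set q := e * (3 - 2 * e).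
have q01 : 0 <= q <= 1 by rewrite /q; apply/andP; split; nra.
have qe j : q ^+ j * e <= e.
  by rewrite ler_piMl ?exprn_ile1//; lra.
elim: k => [|k /andP[IH0 IH]]/=; first by rewrite expr0 mul1r.
have := le_trans IH (qe k); set z := iter _ _ _ in IH0 IH * => ze.
have qk0 : 0 <= q ^+ k by rewrite exprn_ge0//; lra.
rewrite exprS -mulrA /smoothstep; apply/andP; split; first nra.
rewrite (_ : _ - _ = z * (3 - 2 * z) * z); last by ring.
apply: ler_pM => //; [nra|rewrite /q; nra].
Qed.

(** A sine slow enough to be monotone on [-A, A] gives a gentle slope through 1/2 at [x]; iterating
    [smoothstep] sharpens it and keeps all values in [0, 1], also outside [-A, A]. *)
Lemma trig_poly_step x (delta eps A : R) : 0 < delta -> 0 < eps -> 0 <= A ->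
  exists h, [/\ trig_poly h, forall y, 0 <= h y <= 1,
    forall y, `|y| <= A -> y <= x - delta -> 1 - eps <= h y &
    forall y, `|y| <= A -> x + delta <= y -> h y <= eps].
Proof.
move=> d0 e0 A0.
(* On [-A, A] the argument (y - x) / K then stays in [-1, 1], where sine increases. The summand
   [delta] makes [K] positive and delta / K at most 1. *)
pose K := A + `|x| + delta.
have K0 : 0 < K by rewrite ltr_wpDl// addr_ge0.
pose s0 := sin (K^-1 * delta).
(* The value at x + delta of the function [v] below; its value at x - delta is 1 - e. *)
pose e := (1 - s0) / 2.
have Kd0 : 0 < K^-1 * delta by rewrite mulr_gt0// invr_gt0.
have Kd1 : K^-1 * delta <= 1.
  by rewrite mulrC ler_pdivrMr// mul1r /K lerDr addr_ge0.
have pi1 := @pihalf_ge1 R.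
have s01 : 0 < s0 <= 1.
  rewrite sin_le1 andbT sin_gt0_pi// Kd0/= (le_lt_trans Kd1)//.
  by rewrite (lt_le_trans _ (@pi_ge2 R))// ltr1n.
have e12 : 0 <= e < 2^-1 by rewrite /e; lra.
pose q := e * (3 - 2 * e).
have q01 : 0 <= q < 1 by rewrite /q; apply/andP; split; nra.
have [k qk] : exists k, q ^+ k * e <= eps.
  have /cvgr0Pnorm_le/(_ _ e0)[k _ /(_ k (leqnn k)) kq] : q ^+ n @[n --> \oo] --> 0.
    by apply: cvg_expr; rewrite ger0_norm; lra.
  exists k; rewrite (le_trans _ kq)//= (le_trans _ (ler_norm _))//.
  by rewrite ler_piMr ?exprn_ge0//; lra.
have sin_le y z : - 1 <= y -> z <= 1 -> y <= z -> sin y <= sin z.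
  move=> y1 z1 yz; have [->//|yz'] := eqVneq y z.
  rewrite ltW// ltr_sin// ?in_itv/=; [by rewrite lt_neqAle yz'|lra|lra].
(* [v] crosses 1/2 at [x] only, as long as [`|y| <= A]. *)
pose v y := (1 - sin (K^-1 * (y - x))) / 2.
have v01 y : 0 <= v y <= 1.
  by have := sin_le1 (K^-1 * (y - x)); have := sin_geN1 (K^-1 * (y - x)); rewrite /v; lra.
have tv : trig_poly v.
  rewrite (_ : v = (fun y => 2^-1 + 2^-1 * cos (K^-1 * y + (pi / 2 - K^-1 * x)))).
    by apply: TrigAdd; [exact: trig_poly_cst|exact: TrigCos].
  apply/funext => y.
  have -> : K^-1 * y + (pi / 2 - K^-1 * x) = K^-1 * (y - x) + pi / 2 by ring.
  by rewrite /v cosDpihalf; move: (sin _) => z; field.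
have Kle y : `|y| <= A -> - 1 <= K^-1 * (y - x) <= 1.
  move=> yA; rewrite -ler_norml normrM gtr0_norm ?invr_gt0//.
  rewrite mulrC ler_pdivrMr// mul1r (le_trans (ler_normB _ _))//.
  by rewrite (le_trans (lerD yA (lexx _)))// lerDl ltW.
exists (fun y => iter k smoothstep (v y)); split.
- exact: trig_poly_iter_smoothstep.
- by move=> y; exact: iter_smoothstep01.
- move=> y yA yx.
  (* To the left of [x], the symmetry of [smoothstep] about 1/2 reduces the claim to the decay of
     the iterates of 1 - v y. *)
  have ve : 0 <= 1 - v y <= e.
    have /andP[Ky _] := Kle y yA; have /andP[v0 v1] := v01 y.
    rewrite subr_ge0 v1 /v /e /=.
    have : sin (K^-1 * (y - x)) <= - s0.
      rewrite /s0 -sinN; apply: sin_le => //; first lra.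
      by rewrite -mulrN ler_pM2l ?invr_gt0//; lra.
    by rewrite -/s0; move: (sin (_ * (y - x))) => a; lra.
  have /andP[_] := iter_smoothstep_le k e12 ve.
  rewrite iter_smoothstepC -/q; lra.
- move=> y yA yx.
  have ve : 0 <= v y <= e.
    have /andP[_ Ky] := Kle y yA; have /andP[v0 v1] := v01 y.
    rewrite v0 /v /e /=.
    have : s0 <= sin (K^-1 * (y - x)).
      apply: sin_le => //; first lra.
      by rewrite ler_pM2l ?invr_gt0//; lra.
    by rewrite -/s0; move: (sin (_ * (y - x))) => a; lra.
  by have /andP[_ /le_trans] := iter_smoothstep_le k e12 ve; apply.
Qed.

Lemma trig_poly_continuous f : trig_poly f -> continuous f.
Proof.
elim=> {f} [a u v|f g _ cf _ cg] y; last by apply: cvgD; [exact: cf|exact: cg].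
apply: cvgM; first exact: cvg_cst.
apply: continuous_comp; last exact: continuous_cos.
by apply: cvgD; [apply: cvgM => //; exact: cvg_cst|exact: cvg_cst].
Qed.

Lemma trig_poly_bounded f : trig_poly f -> exists M, forall y, `|f y| <= M.
Proof.
elim=> {f} [a u v|f g _ [M fM] _ [N gN]].
  by exists `|a| => y; rewrite normrM ler_piMr// cos_max.
by exists (M + N) => y; rewrite (le_trans (ler_normD _ _))// lerD.
Qed.

End TrigonometricPolynomials.

(** * Distribution functions compared with expectations of trigonometric polynomials *)

Section BoundedExpectations.
Context {R : realType} {d : measure_display} {T : measurableType d}.
Variables (P : probability T R) (X : {RV P >-> R}).

Lemma integrable_bounded (f : T -> R) (M : R) :
  measurable_fun setT f -> (forall w, `|f w| <= M) -> P.-integrable setT (EFin \o f).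
Proof.
move=> mf fM; apply: measurable_bounded_integrable => //.
  by rewrite ltey_eq fin_num_measure.
by exists M; split; [exact: num_real|move=> N MN w _ /=; rewrite (le_trans (fM w))// ltW].
Qed.

Lemma integrable_trig_poly (f : R -> R) :
  trig_poly f -> P.-integrable setT (EFin \o (f \o X)).
Proof.
move=> tf; have [M fM] := trig_poly_bounded tf.
apply: (@integrable_bounded _ M) => [|w]; last exact: fM.
by apply: measurableT_comp => //; apply: continuous_measurable_fun; exact: trig_poly_continuous.
Qed.

Lemma Rintegral_indic (A : set T) : measurable A ->
  \int[P]_w (\1_A w : R) = fine (P A).
Proof. by move=> mA; rewrite /Rintegral integral_indic// setIT. Qed.

Lemma integrable_indic_probability (A : set T) : measurable A ->
  P.-integrable setT (EFin \o (\1_A : T -> R)).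
Proof.
move=> mA; apply: (@integrable_bounded _ 1); first exact: measurable_indic.
by move=> w; rewrite indicE; case: (_ \in _); rewrite ?normr1 ?normr0.
Qed.

Lemma measurable_tail (A : R) : measurable [set w | A < `|X w|].
Proof.
rewrite (_ : [set w | _] = (fun w => `|X w|) @^-1` `]A, +oo[%classic); last first.
  by apply/seteqP; split => w /=; rewrite in_itv/= andbT.
rewrite -[X in measurable X]setTI; apply: (_ : measurable_fun setT (fun w => `|X w|)) => //.
exact: measurableT_comp.
Qed.

(** Integrates the pointwise bound 1[X <= x] <= h(X) + eps + 1[|X| > A]. *)
Lemma cdf_le_Rintegral (h : R -> R) (x eps A : R) : 0 <= eps -> trig_poly h ->
  (forall y, 0 <= h y <= 1) ->
  (forall y, `|y| <= A -> y <= x -> 1 - eps <= h y) ->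
  fine (cdf X x) <= \int[P]_w h (X w) + eps + fine (P [set w | A < `|X w|]).
Proof.
move=> e0 th h01 hle.
have mB : measurable (X @^-1` `]-oo, x]%classic) by exact: measurable_sfunP.
have mA := measurable_tail A.
have ih := integrable_trig_poly th.
have ic : P.-integrable setT (EFin \o (cst eps : T -> R)).
  by apply: (@integrable_bounded _ `|eps|).
have iA := integrable_indic_probability mA.
rewrite -[cdf X x]/(P (X @^-1` `]-oo, x]%classic)) -!Rintegral_indic//.
have -> : eps = \int[P]_w eps by rewrite Rintegral_cst//= probability_setT mulr1.
rewrite -!RintegralD//; last first.
  exact: (integrableD measurableT ih ic).
apply: le_Rintegral => //.
- exact: integrable_indic_probability.
- exact: (integrableD measurableT (integrableD measurableT ih ic) iA).
move=> w _; have /andP[h0 h1] := h01 (X w).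
rewrite !indicE; case: (boolP (w \in _)) => /=; last first.
  by move=> _; rewrite !addr_ge0//; case: (_ \in _).
rewrite inE/= in_itv/= => Xx; have [XA|AX] := leP `|X w| A; last first.
  by rewrite mem_set//= lerDr addr_ge0.
have := hle _ XA Xx; case: (_ \in _) => /=; lra.
Qed.

(** Integrates h(X) <= 1[X <= x] + eps + 1[|X| > A]; where an indicator is 1, the bound h <= 1
    suffices. *)
Lemma Rintegral_le_cdf (h : R -> R) (x eps A : R) : 0 <= eps -> trig_poly h ->
  (forall y, 0 <= h y <= 1) ->
  (forall y, `|y| <= A -> x <= y -> h y <= eps) ->
  \int[P]_w h (X w) <= fine (cdf X x) + eps + fine (P [set w | A < `|X w|]).
Proof.
move=> e0 th h01 hle.
have mB : measurable (X @^-1` `]-oo, x]%classic) by exact: measurable_sfunP.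
have mA := measurable_tail A.
have ih := integrable_trig_poly th.
have ic : P.-integrable setT (EFin \o (cst eps : T -> R)).
  by apply: (@integrable_bounded _ `|eps|).
have iA := integrable_indic_probability mA.
have iB := integrable_indic_probability mB.
rewrite -[cdf X x]/(P (X @^-1` `]-oo, x]%classic)) -!Rintegral_indic//.
have -> : eps = \int[P]_w eps by rewrite Rintegral_cst//= probability_setT mulr1.
rewrite -!RintegralD//; last first.
  exact: (integrableD measurableT iB ic).
apply: le_Rintegral => //.
- exact: (integrableD measurableT (integrableD measurableT iB ic) iA).
move=> w _; have /andP[h0 h1] := h01 (X w).
rewrite !indicE; case: (boolP (w \in _)) => /=.
  move=> _; case: (_ \in _) => /=; lra.
rewrite notin_setE/= in_itv/= => /negP; rewrite -ltNge => /ltW xX.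
have [XA|AX] := leP `|X w| A; last by rewrite mem_set//=; lra.
by have := hle _ XA xX; case: (_ \in _) => /=; lra.
Qed.
End BoundedExpectations.

(** * Convergence in distribution from cosine expectations and tightness *)

Section LevyContinuity.
Context {R : realType} {d : nat -> measure_display} {T : forall n, measurableType (d n)}.
Variables (P : forall n, probability (T n) R) (X : forall n, {RV (P n) >-> R}).
Variable mu : probability (measurableTypeR R) R.
Hypothesis cos_cvg : forall u v : R,
  \int[P n]_w cos (u * X n w + v) @[n --> \oo] --> \int[mu]_y cos (u * y + v).
Hypothesis tightP : forall eps : R, 0 < eps ->
  exists A : R, \forall n \near \oo, fine (P n [set w | A < `|X n w|]) <= eps.

(** The identity is a random variable of law [mu], so the comparisons proved for random variables
    apply to the limit too. *)
Let idTR : measurableTypeR R -> R := idfun.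

#[local] HB.instance Definition _ :=
  @isMeasurableFun.Build _ _ _ _ idTR (@measurable_id _ _ setT).

Let Y : {RV mu >-> R} := idTR.

Lemma trig_poly_cvg (f : R -> R) : trig_poly f ->
  \int[P n]_w f (X n w) @[n --> \oo] --> \int[mu]_w f (Y w).
Proof.
have tcos u v : trig_poly (fun y : R => cos (u * y + v)).
  rewrite (_ : (fun _ => _) = (fun y => 1 * cos (u * y + v))); first exact: TrigCos.
  by under [RHS]eq_fun do rewrite mul1r.
elim=> {f} [a u v|f g tf cf tg cg].
  rewrite RintegralZl//; last exact: (integrable_trig_poly Y (tcos u v)).
  rewrite (_ : (fun n => _) = (fun n => a * \int[P n]_w cos (u * X n w + v))).
    by apply: cvgM; [exact: cvg_cst|exact: cos_cvg].
  apply/funext => n; rewrite RintegralZl//.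
  exact: (integrable_trig_poly (X n) (tcos u v)).
rewrite RintegralD//; [|exact: (integrable_trig_poly Y tf)|exact: (integrable_trig_poly Y tg)].
rewrite (_ : (fun n => _) = (fun n => \int[P n]_w f (X n w) + \int[P n]_w g (X n w))).
  exact: cvgD.
apply/funext => n; rewrite RintegralD//; [exact: (integrable_trig_poly (X n) tf)|].
exact: (integrable_trig_poly (X n) tg).
Qed.

(** The tails decrease to the empty set; continuity from above concludes. *)
Lemma tight_probability (eps : R) : 0 < eps ->
  exists A : R, fine (mu [set w | A < `|Y w|]) <= eps.
Proof.
move=> e0; pose F (n : nat) := [set w | n%:R < `|Y w|].
have mF n : measurable (F n) by exact: measurable_tail.
have capF : \bigcap_n F n = set0.
  apply/seteqP; split => // y /(_ (Num.truncn `|Y y|).+1 I) /=.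
  by rewrite /F /= ltNge ltW// truncnS_gt.
have niF : nonincreasing_seq F.
  move=> i j ij; apply/subsetPset => y /=; apply: le_lt_trans.
  by rewrite ler_nat.
have muF : (mu (F 0%N) < +oo)%E by rewrite ltey_eq fin_num_measure.
have := nonincreasing_cvg_mu muF mF; rewrite capF measure0 => /(_ measurable0 niF).
move=> /fine_cvg /cvgr0Pnorm_le /(_ _ e0)[n _ /(_ n (leqnn n))] /= Fn.
by exists n%:R; rewrite (le_trans (ler_norm _)).
Qed.

(** The distribution function of [X n] at [x] is squeezed between expectations of two trigonometric
    polynomials, stepping down just left and just right of [x]. These expectations converge, and
    continuity of the limit at [x] closes the gap. *)
Theorem cvg_in_distribution_cos : cvg_in_distribution P X mu.
Proof.
move=> x cx.
have cdfY t : mu `]-oo, t]%classic = cdf Y t by [].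
have fmu t : mu `]-oo, t]%classic \is a fin_num by exact: fin_num_measure.
pose Phi t := fine (mu `]-oo, t]%classic).
have {}cx : Phi t @[t --> x] --> Phi x.
  move: cx; rewrite /continuous_at -[X in _ --> X -> _]fineK// => /fine_cvg.
  exact.
rewrite -[X in _ --> X]fineK//; apply: cvg_EFin.
  by apply: nearW => n; exact: fin_num_measure.
apply/cvgrPdist_le => e e0.
(* Each side collects six errors of e / 8: two from each of two comparisons with a step, one from
   the convergence of expectations, one from continuity at [x]. *)
have e8 : 0 < e / 8 by rewrite divr_gt0.
have /cvgrPdist_le/(_ _ e8)[del /= del0 hdel] := cx.
have [A1 hA1] := tightP e8.
have [A2 hA2] := tight_probability e8.
(* One window for the sequence and the limit; absolute values, because [A1] and [A2] may be
   negative. *)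
pose A := `|A1| + `|A2|.
have A1A y : `|y| <= A1 -> `|y| <= A.
  by move/le_trans; apply; rewrite (le_trans (ler_norm _))// lerDl.
have A2A y : `|y| <= A2 -> `|y| <= A.
  by move/le_trans; apply; rewrite (le_trans (ler_norm _))// lerDr.
have A0 : 0 <= A by rewrite addr_ge0.
(* The transition zones [x, x + 2 dl] of [hp] and [x - 2 dl, x] of [hm] then lie within [del] of
   [x]. *)
pose dl := del / 4.
have dl0 : 0 < dl by rewrite divr_gt0.
have e8' := ltW e8.
have [hp [thp hp01 hp1 hp0]] := trig_poly_step (x + dl) dl0 e8 A0.
have [hm [thm hm01 hm1 hm0]] := trig_poly_step (x - dl) dl0 e8 A0.
have Pp : Phi (x + 2 * dl) <= Phi x + e / 8.
  have : `|Phi x - Phi (x + 2 * dl)| <= e / 8.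
    by apply: hdel; rewrite /= opprD addrA subrr sub0r normrN gtr0_norm ?mulr_gt0// /dl; lra.
  by rewrite ler_norml; lra.
have Pm : Phi x - e / 8 <= Phi (x - 2 * dl).
  have : `|Phi x - Phi (x - 2 * dl)| <= e / 8.
    by apply: hdel; rewrite /= opprB addrC subrK gtr0_norm ?mulr_gt0// /dl; lra.
  by rewrite ler_norml; lra.
have up : \int[mu]_w hp (Y w) <= Phi (x + 2 * dl) + e / 8 + e / 8.
  apply: le_trans (Rintegral_le_cdf Y (x := x + 2 * dl) (A := A2) e8' thp hp01 _) _.
    by move=> y yA xy; apply: hp0; [exact: A2A|lra].
  by rewrite lerD2l.
have low : Phi (x - 2 * dl) <= \int[mu]_w hm (Y w) + e / 8 + e / 8.
  apply: le_trans (cdf_le_Rintegral Y (x := x - 2 * dl) (A := A2) e8' thm hm01 _) _.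
    by move=> y yA xy; apply: hm1; [exact: A2A|lra].
  by rewrite lerD2l.
have /cvgrPdist_le/(_ _ e8) cp := trig_poly_cvg thp.
have /cvgrPdist_le/(_ _ e8) cm := trig_poly_cvg thm.
near=> n.
have upn : fine (cdf (X n) x) <= \int[P n]_w hp (X n w) + e / 8 + e / 8.
  apply: le_trans (cdf_le_Rintegral (X n) (x := x) (A := A1) e8' thp hp01 _) _.
    by move=> y yA xy; apply: hp1; [exact: A1A|lra].
  by rewrite lerD2l; near: n.
have lown : \int[P n]_w hm (X n w) <= fine (cdf (X n) x) + e / 8 + e / 8.
  apply: le_trans (Rintegral_le_cdf (X n) (x := x) (A := A1) e8' thm hm01 _) _.
    by move=> y yA xy; apply: hm0; [exact: A1A|lra].
  by rewrite lerD2l; near: n.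
have cpn : `|\int[mu]_w hp (Y w) - \int[P n]_w hp (X n w)| <= e / 8 by near: n.
have cmn : `|\int[mu]_w hm (Y w) - \int[P n]_w hm (X n w)| <= e / 8 by near: n.
move: cpn cmn; rewrite -/(Phi x) !ler_norml /=; lra.
Unshelve. all: by end_near. Qed.
End LevyContinuity.

(** * Factorization, mean and variance of the q-Catalan polynomials *)

Section QCatalanFactorization.
Variable F : fieldType.

Lemma qfact_addn (a r : nat) :
  qfact F (a + r) = qfact F a * \prod_(i < r) qint F (a + i).+1.
Proof.
elim: r => [|r IH]; first by rewrite addn0 big_ord0 mulr1.
by rewrite addnS qfactS IH big_ord_recr /= mulrA.
Qed.

(** With n = r + 1, the quotient by [(m-1)n + 1] removes the first factor of [(m-1)n + 1]...[mn],
    and [1] = 1 drops out of [n]!; so r factors remain on each side, paired by index. *)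
Lemma qCatalan_prod (m r : nat) : (0 < m)%N ->
  qCatalan F r.+1 m * \prod_(i < r) qint F i.+2 =
  \prod_(i < r) qint F ((m - 1) * r.+1 + i.+2).
Proof.
move=> m0; set N := ((m - 1) * r.+1)%N.
have mE : (m * r.+1 = N + r.+1)%N by rewrite /N mulnBl mul1n subnK// leq_pmull.
have le : (r.+1 <= m * r.+1)%N by rewrite leq_pmull.
have := qbinE F le; rewrite -qCatalanE// mE addnK -/N.
have -> : qfact F r.+1 = qfact F 1 * \prod_(i < r) qint F i.+2.
  by rewrite -qfact_addn add1n.
have -> : qfact F (N + r.+1) = qfact F (N + 1) * \prod_(i < r) qint F (N + 1 + i).+1.
  by rewrite -qfact_addn addn1 addnS.
have -> : qfact F 1 = 1 by rewrite qfactS qfact0 mul1r /qint big_ord1.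
have NX : qfact F (N + 1) != 0 by exact: qfact_neq0.
rewrite mul1r => E; apply: (mulfI NX).
transitivity (qfact F (N + 1) * \prod_(i < r) qint F (N + 1 + i).+1); last first.
  by congr (_ * _); apply: eq_bigr => i _; rewrite addn1 !addnS addSn.
rewrite -E [in LHS]addn1 qfactS addn1.
by rewrite [qfact F N * _]mulrC [LHS]mulrC -!mulrA; congr (_ * _); rewrite mulrC !mulrA mulrAC.
Qed.
End QCatalanFactorization.

(** * Mean and variance of a generating function *)

Section Dispersion.
Context {F : numFieldType}.
Implicit Types p q : {poly F}.

(* Mean and variance of the law with generating function [p / p.[1]], computed
   from the factorial moments. *)
Definition pmean p : F := p^`().[1] / p.[1].
Definition pvar p : F := p^`(2).[1] / p.[1] + pmean p - pmean p ^+ 2.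

(** A logarithmic derivative at 1 is additive on products, so the contribution of known factors can
    be subtracted. *)
Lemma pmeanM p q : p.[1] != 0 -> q.[1] != 0 -> pmean (p * q) = pmean p + pmean q.
Proof. by move=> p1 q1; rewrite /pmean derivM hornerD !hornerM; field; apply/andP. Qed.

(** [pvar p] is the second derivative of log p(e^s) at s = 0, hence additive. *)
Lemma pvarM p q : p.[1] != 0 -> q.[1] != 0 -> pvar (p * q) = pvar p + pvar q.
Proof.
move=> p1 q1; rewrite /pvar /pmean !derivnS !derivn0 !derivM derivD !derivM !(hornerD, hornerM).
by field; apply/andP.
Qed.

Lemma horner_qint1 n : (qint F n).[1] = n%:R.
Proof.
rewrite /qint horner_sum (eq_bigr (fun=> 1)) ?sumr_const ?card_ord// => i _.
by rewrite hornerXn expr1n.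
Qed.

Lemma horner_deriv_qint1 n : (qint F n.+1)^`().[1] = n.+1%:R * n%:R / 2.
Proof.
elim: n => [|n IH].
  by rewrite /qint big_ord1 expr0 derivC horner0 mulr0 mul0r.
rewrite qintS derivD hornerD IH derivXn hornerMn hornerXn expr1n.
by rewrite -!natr1; field.
Qed.

Lemma horner_deriv2_qint1 n :
  (qint F n.+1)^`(2).[1] = n.+1%:R * n%:R * (n%:R - 1) / 3.
Proof.
elim: n => [|n IH].
  rewrite /qint big_ord1 expr0 !derivnS derivn0 derivC linear0 horner0.
  by rewrite mulr0 !mul0r.
rewrite qintS derivnD hornerD IH !derivnS derivn0 derivXn derivMn derivXn.
rewrite !hornerMn hornerXn expr1n -[n.+1.-1]/n -mulr_natr.
by rewrite -!natr1; field.
Qed.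

(** [qint n] generates the uniform law on 0, ..., n - 1. *)
Lemma pmean_qint n : (0 < n)%N -> pmean (qint F n) = (n%:R - 1) / 2.
Proof.
case: n => // n _; rewrite /pmean horner_deriv_qint1 horner_qint1.
by rewrite -!natr1; field; rewrite natr1 pnatr_eq0.
Qed.

Lemma pvar_qint n : (0 < n)%N -> pvar (qint F n) = (n%:R ^+ 2 - 1) / 12.
Proof.
case: n => // n _; rewrite /pvar /pmean horner_deriv2_qint1 horner_deriv_qint1.
by rewrite horner_qint1 -!natr1; field; rewrite natr1 pnatr_eq0.
Qed.

Lemma horner_derivn1_sum (n : nat) p :
  p^`(n).[1] = \sum_(k < size p) p`_k * (k ^_ n)%:R.
Proof.
rewrite -{1}[p]coefK poly_def linear_sum horner_sum; apply: eq_bigr => k _.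
by rewrite /= derivnZ hornerZ derivnXn hornerMn hornerXn expr1n.
Qed.

Lemma horner_prod_qint1 (r a : nat) :
  (\prod_(i < r) qint F (a + i.+2)).[1] != 0.
Proof.
rewrite horner_prod; apply/prodf_neq0 => i _.
by rewrite horner_qint1 addnS pnatr_eq0.
Qed.

Lemma pmean_prod_qint (r a : nat) :
  pmean (\prod_(i < r) qint F (a + i.+2)) = \sum_(i < r) ((a + i.+2)%:R - 1) / 2.
Proof.
elim: r => [|r IH].
  by rewrite !big_ord0 /pmean derivC horner0 mul0r.
rewrite !big_ord_recr/= pmeanM ?horner_prod_qint1 ?horner_qint1 ?addnS ?pnatr_eq0//.
by rewrite -addnS -addnS IH pmean_qint// addnS.
Qed.

Lemma pvar_prod_qint (r a : nat) :
  pvar (\prod_(i < r) qint F (a + i.+2)) = \sum_(i < r) ((a + i.+2)%:R ^+ 2 - 1) / 12.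
Proof.
elim: r => [|r IH].
  rewrite !big_ord0 /pvar /pmean !derivnS derivn0 derivC linear0 horner0.
  by rewrite !mul0r expr0n/= addr0 subr0.
rewrite !big_ord_recr/= pvarM ?horner_prod_qint1 ?horner_qint1 ?addnS ?pnatr_eq0//.
by rewrite -addnS -addnS IH pvar_qint// addnS.
Qed.

Lemma qCatalan1_neq0 (m r : nat) : (0 < m)%N -> (qCatalan F r.+1 m).[1] != 0.
Proof.
move=> m0; have := horner_prod_qint1 r ((m - 1) * r.+1).
by rewrite -qCatalan_prod// hornerM mulf_eq0 negb_or => /andP[].
Qed.

(** Paired factors in [qCatalan_prod] have means differing by (m-1)n / 2. The sum is left
    unevaluated to match the phases termwise in [trig_sum_qCatalan]. *)
Lemma pmean_qCatalan (m r : nat) : (0 < m)%N ->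
  pmean (qCatalan F r.+1 m) = \sum_(i < r) ((m - 1) * r.+1)%:R / 2.
Proof.
move=> m0; have := pmean_prod_qint r ((m - 1) * r.+1).
rewrite -qCatalan_prod// pmeanM ?qCatalan1_neq0//; last exact: (horner_prod_qint1 r 0).
rewrite (pmean_prod_qint r 0) => /(canRL (addrK _)) ->.
by rewrite -sumrB; apply: eq_bigr => i _; rewrite add0n natrD; field.
Qed.

Lemma pvar_qCatalan (m r : nat) : (0 < m)%N ->
  pvar (qCatalan F r.+1 m) =
  \sum_(i < r) (((m - 1) * r.+1 + i.+2)%:R ^+ 2 - i.+2%:R ^+ 2) / 12.
Proof.
move=> m0; have := pvar_prod_qint r ((m - 1) * r.+1).
rewrite -qCatalan_prod// pvarM ?qCatalan1_neq0//; last exact: (horner_prod_qint1 r 0).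
rewrite (pvar_prod_qint r 0) => /(canRL (addrK _)) ->.
by rewrite -sumrB; apply: eq_bigr => i _; rewrite add0n; field.
Qed.
End Dispersion.

(** * Characteristic functions of polynomials in q *)

Section TrigSums.
Context {R : realType}.
Implicit Types (p : {poly R}) (t v : R).

(* Real part of [expR ('i v) * p.[expR ('i t)]]. *)
Definition trig_sum p t v : R := \sum_(k < size p) p`_k * cos (k%:R * t + v).

Lemma horner1_sum p : p.[1] = \sum_(k < size p) p`_k.
Proof. by rewrite horner_coef; apply: eq_bigr => k _; rewrite expr1n mulr1. Qed.

Lemma trig_sum_widen p t v (n : nat) : (size p <= n)%N ->
  trig_sum p t v = \sum_(k < n) p`_k * cos (k%:R * t + v).
Proof.
move=> pn; rewrite /trig_sum (big_ord_widen n (fun k => p`_k * cos (k%:R * t + v)) pn).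
rewrite big_mkcond; apply: eq_bigr => k _; case: ltnP => // ?.
by rewrite nth_default ?mul0r.
Qed.

Lemma trig_sumD p q t v : trig_sum (p + q) t v = trig_sum p t v + trig_sum q t v.
Proof.
have pq := size_polyD p q.
rewrite (@trig_sum_widen (p + q) _ _ _ pq) (@trig_sum_widen p _ _ _ (leq_maxl _ (size q))).
rewrite (@trig_sum_widen q _ _ _ (leq_maxr (size p) _)) -big_split/=.
by apply: eq_bigr => k _; rewrite coefD mulrDl.
Qed.

Lemma trig_sum0 t v : trig_sum 0 t v = 0.
Proof. by rewrite /trig_sum size_poly0 big_ord0. Qed.

(** Multiplication by q = exp(it) advances the phase by t. *)
Lemma trig_sumMX p t v : trig_sum (p * 'X) t v = trig_sum p t (t + v).
Proof.
have [->|p0] := eqVneq p 0; first by rewrite mul0r !trig_sum0.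
rewrite /trig_sum size_mulX// big_ord_recl coefMX/= mul0r add0r.
apply: eq_bigr => k _; rewrite coefMX/= /bump/= add1n -natr1.
by congr (_ * cos _); ring.
Qed.

Lemma trig_sumMXn p n t v : trig_sum (p * 'X^n) t v = trig_sum p t (n%:R * t + v).
Proof.
elim: n v => [|n IH] v; first by rewrite expr0 mulr1 mul0r add0r.
by rewrite exprSr mulrA trig_sumMX IH -natr1; congr trig_sum; ring.
Qed.

Lemma trig_sumM_qint p n t v : trig_sum (p * qint R n) t v =
  \sum_(j < n) trig_sum p t (j%:R * t + v).
Proof.
elim: n => [|n IH]; first by rewrite /qint !big_ord0 mulr0 trig_sum0.
by rewrite qintS mulrDr trig_sumD IH big_ord_recr/= trig_sumMXn.
Qed.

(** At phase - pi / 2 the sum is the imaginary part of p at exp(it), so the dependence on [v] is a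
    rotation. *)
Lemma trig_sum_phase p t v :
  trig_sum p t v = trig_sum p t 0 * cos v - trig_sum p t (- (pi / 2)) * sin v.
Proof.
rewrite /trig_sum !big_distrl -sumrB/=; apply: eq_bigr => k _.
by rewrite cosBpihalf cosD addr0; ring.
Qed.

(* [1 + expR ('i t) + ... + expR ('i (n - 1) t)] is [sin (n t / 2) / sin (t / 2)] times
   [expR ('i (n - 1) t / 2)]; both sides are multiplied by [sin (t / 2)]. *)
Lemma sum_cos_arith n t v :
  sin (t / 2) * \sum_(j < n) cos (j%:R * t + v) =
  sin (n%:R * t / 2) * cos ((n%:R - 1) / 2 * t + v).
Proof.
have prod a b : sin a * cos b = (sin (a + b) + sin (a - b)) / 2 :> R.
  by rewrite sinD sinB; field.
elim: n => [|n IH]; first by rewrite big_ord0 mul0r mul0r sin0 mul0r mulr0.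
rewrite big_ord_recr/= mulrDr IH !prod -mulrDl; congr (_ / 2).
have -> : n.+1%:R = n%:R + 1 :> R by rewrite natr1.
set N := n%:R : R.
have -> : N * t / 2 - ((N - 1) / 2 * t + v) = t / 2 - v by field.
have -> : N * t / 2 + ((N - 1) / 2 * t + v) = - (t / 2 - (N * t + v)) by field.
have -> : (N + 1) * t / 2 - ((N + 1 - 1) / 2 * t + v) = t / 2 - v by field.
have -> : (N + 1) * t / 2 + ((N + 1 - 1) / 2 * t + v) = t / 2 + (N * t + v) by field.
by rewrite sinN; ring.
Qed.

(** A factor [n] contributes a real amplitude and a rotation by t times its mean (n - 1) / 2. *)
Lemma trig_sumM_qint_phase p n t v :
  sin (t / 2) * trig_sum (p * qint R n) t v =
  sin (n%:R * t / 2) * trig_sum p t ((n%:R - 1) / 2 * t + v).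
Proof.
rewrite trig_sumM_qint.
under eq_bigr => j _ do rewrite trig_sum_phase.
rewrite [in RHS]trig_sum_phase sumrB -!mulr_sumr !mulrBr.
congr (_ - _).
  by rewrite mulrCA sum_cos_arith mulrCA.
rewrite mulrCA [RHS]mulrCA; congr (_ * _).
(* The sine sum is the cosine sum with its phase moved back by pi / 2. *)
have := sum_cos_arith n t (v - pi / 2).
under eq_bigr => j _ do rewrite addrA cosBpihalf.
by rewrite addrA cosBpihalf.
Qed.

Lemma trig_sum_prod_qint p (r a : nat) t v :
  sin (t / 2) ^+ r * trig_sum (p * \prod_(i < r) qint R (a + i.+2)) t v =
  (\prod_(i < r) sin ((a + i.+2)%:R * t / 2)) *
  trig_sum p t (\sum_(i < r) ((a + i.+2)%:R - 1) / 2 * t + v).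
Proof.
elim: r v => [|r IH] v; first by rewrite !big_ord0 expr0 !mul1r mulr1 add0r.
rewrite !big_ord_recr/= mulrA exprSr -mulrA trig_sumM_qint_phase.
by rewrite mulrCA IH mulrA [X in X * _]mulrC -addrA.
Qed.

Lemma trig_sum1 t v : trig_sum 1 t v = cos v.
Proof. by rewrite /trig_sum size_poly1 big_ord1 coef1/= mul1r mul0r add0r. Qed.

(** [trig_sum_prod_qint] is applied to both sides of [qCatalan_prod]; the powers of sin(t / 2)
    coincide, and only the sines of the denominator factors are divided out. *)
Lemma trig_sum_qCatalan (m r : nat) t v : (0 < m)%N ->
  (forall i : 'I_r, sin (i.+2%:R * t / 2) != 0) ->
  trig_sum (qCatalan R r.+1 m) t v =
  (\prod_(i < r) (sin (((m - 1) * r.+1 + i.+2)%:R * t / 2) / sin (i.+2%:R * t / 2))) *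
  cos (pmean (qCatalan R r.+1 m) * t + v).
Proof.
move=> m0 si.
(* The rotation due to the denominator factors; starting from v - c leaves exactly [v] on the
   q-Catalan polynomial. *)
pose c := \sum_(i < r) (i.+2%:R - 1) / 2 * t.
have := trig_sum_prod_qint (qCatalan R r.+1 m) r 0 t (v - c).
rewrite (eq_bigr (fun i : 'I_r => qint R i.+2)) => [|i _]; last by rewrite add0n.
rewrite qCatalan_prod// -[\prod_(i < r) _]mul1r trig_sum_prod_qint trig_sum1.
rewrite [X in trig_sum _ _ X](_ : _ = v) => [E|]; last by rewrite addrCA -/c subrr addr0.
have si0 : \prod_(i < r) sin ((0 + i.+2)%:R * t / 2) != 0.
  by apply/prodf_neq0 => i _; exact: si.
apply: (mulfI si0); rewrite -E prodf_div [RHS]mulrA; congr (_ * cos _).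
  rewrite [RHS]mulrC mulfVK//.
rewrite pmean_qCatalan// mulr_suml addrCA [RHS]addrC; congr (_ + _).
rewrite /c -sumrB; apply: eq_bigr => i _; rewrite natrD; ring.

Qed.
End TrigSums.

(** * Estimates for sin x / x *)

Section SineEstimates.
Context {R : realType}.
Implicit Types x y t u v : R.

Lemma derive_ge0_ge0 (f df : R -> R) x : 0 <= x -> f 0 = 0 ->
  (forall y, is_derive y (1 : R) f (df y)) -> (forall y, 0 <= y -> 0 <= df y) ->
  0 <= f x.
Proof.
move=> x0 f0 dff df0.
have cf : {within `[0, x], continuous f}.
  apply: derivable_within_continuous => y _; exact: ex_derive.
have [c + ] := @MVT_segment R f df 0 x x0 (fun y _ => dff y) cf.
rewrite in_itv/= f0 !subr0 => /andP[c0 _] ->.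
by rewrite mulr_ge0// df0.
Qed.

(** Start of a chain of Taylor bounds: the derivative of each difference is the preceding
    difference, so nonnegativity propagates. *)
Lemma sin_le_id x : 0 <= x -> sin x <= x.
Proof.
move=> x0; rewrite -subr_ge0.
apply: (@derive_ge0_ge0 (fun x => x - sin x) (fun x => 1 - cos x)) => //.
- by rewrite sin0 subr0.
Qed.

Lemma cos_ge_taylor2 x : 0 <= x -> 1 - x ^+ 2 / 2 <= cos x.
Proof.
move=> x0; rewrite -subr_ge0.
apply: (@derive_ge0_ge0 (fun x => cos x - (1 - x ^+ 2 / 2)) (fun x => x - sin x)) => //.
- by rewrite cos0 expr0n/= mul0r subr0 subrr.
- move=> y; eapply trigger_derive; first by typeclasses eauto.
  by rewrite /GRing.scale/=; field.
- by move=> y y0; rewrite subr_ge0 sin_le_id.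
Qed.

Lemma sin_ge_taylor3 x : 0 <= x -> x - x ^+ 3 / 6 <= sin x.
Proof.
move=> x0; rewrite -subr_ge0.
apply: (@derive_ge0_ge0 (fun x => sin x - (x - x ^+ 3 / 6))
  (fun x => cos x - (1 - x ^+ 2 / 2))) => //.
- by rewrite sin0 expr0n/= mul0r !subr0.
- move=> y; eapply trigger_derive; first by typeclasses eauto.
  by rewrite /GRing.scale/=; field.
- by move=> y y0; rewrite subr_ge0 cos_ge_taylor2.
Qed.

Lemma cos_le_taylor4 x : 0 <= x -> cos x <= 1 - x ^+ 2 / 2 + x ^+ 4 / 24.
Proof.
move=> x0; rewrite -subr_ge0.
apply: (@derive_ge0_ge0 (fun x => 1 - x ^+ 2 / 2 + x ^+ 4 / 24 - cos x)
  (fun x => sin x - (x - x ^+ 3 / 6))) => //.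
- by rewrite cos0 !expr0n/= !mul0r subr0 addr0 subrr.
- move=> y; eapply trigger_derive; first by typeclasses eauto.
  by rewrite /GRing.scale/=; field.
- by move=> y y0; rewrite subr_ge0 sin_ge_taylor3.
Qed.

Lemma sin_le_taylor5 x : 0 <= x -> sin x <= x - x ^+ 3 / 6 + x ^+ 5 / 120.
Proof.
move=> x0; rewrite -subr_ge0.
apply: (@derive_ge0_ge0 (fun x => x - x ^+ 3 / 6 + x ^+ 5 / 120 - sin x)
  (fun x => 1 - x ^+ 2 / 2 + x ^+ 4 / 24 - cos x)) => //.
- by rewrite sin0 !expr0n/= !mul0r !subr0 addr0.
- move=> y; eapply trigger_derive; first by typeclasses eauto.
  by rewrite /GRing.scale/=; field.
- by move=> y y0; rewrite subr_ge0 cos_le_taylor4.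
Qed.

(** 1 + z <= exp z applied to the Taylor bound; 1/120 is relaxed to 1/18 to share the error term of
    the lower bound. *)
Lemma sinc_le_expR x : 0 < x -> sin x / x <= expR (- (x ^+ 2 / 6) + x ^+ 4 / 18).
Proof.
move=> x0; rewrite ler_pdivrMr// (le_trans (sin_le_taylor5 (ltW x0)))//.
have -> : x - x ^+ 3 / 6 + x ^+ 5 / 120 = (1 + (- (x ^+ 2 / 6) + x ^+ 4 / 120)) * x by field.
rewrite ler_wpM2r ?(ltW x0)// (le_trans (expR_ge1Dx _))// ler_expR lerD2l.
by rewrite ler_wpM2l ?exprn_even_ge0// lef_pV2 ?posrE ?ltr0n// ler_nat.
Qed.

(** With z = x^2/6 <= 1/6 this reduces to exp(-(z + 2 z^2)) <= 1 - z, which holds because (1 - z)(1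
    + z + 2 z^2) = 1 + z^2 (1 - 2 z) >= 1. *)
Lemma sinc_ge_expR x : 0 < x <= 1 -> expR (- (x ^+ 2 / 6) - x ^+ 4 / 18) <= sin x / x.
Proof.
move=> /andP[x0 x1]; rewrite ler_pdivlMr//.
rewrite (le_trans _ (sin_ge_taylor3 (ltW x0)))//.
have -> : x - x ^+ 3 / 6 = (1 - x ^+ 2 / 6) * x by field.
rewrite ler_wpM2r ?(ltW x0)//.
have -> : - (x ^+ 2 / 6) - x ^+ 4 / 18 = - (x ^+ 2 / 6 + 2 * (x ^+ 2 / 6) ^+ 2) by field.
have : 0 <= x ^+ 2 / 6 by rewrite divr_ge0 ?sqr_ge0.
have : x ^+ 2 / 6 <= 1 / 6 by rewrite ler_pM2r ?invr_gt0// expr_le1// ltW.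
move: (x ^+ 2 / 6) => z z6 z0.
rewrite expRN -div1r ler_pdivrMr ?expR_gt0//.
rewrite (le_trans _ (ler_wpM2l _ (expR_ge1Dx _)))//; last lra.
have : 0 <= z ^+ 2 * (1 - 2 * z) by rewrite mulr_ge0 ?sqr_ge0//; lra.
rewrite -subr_ge0 (_ : _ - 1 = z ^+ 2 * (1 - 2 * z)); last by ring.
by [].
Qed.

(** Numerators and denominators are bounded in opposite directions, so second-order terms subtract
    while fourth-order errors add. *)
Lemma prod_sinc_ratio_bounds (r : nat) (a b : 'I_r -> R) :
  (forall i, 0 < a i <= 1) -> (forall i, 0 < b i <= 1) ->
  let q := \prod_(i < r) ((sin (a i) / a i) / (sin (b i) / b i)) in
  let s := \sum_(i < r) (a i ^+ 2 - b i ^+ 2) / 6 in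
  let e := \sum_(i < r) (a i ^+ 4 + b i ^+ 4) / 18 in
  expR (- s - e) <= q <= expR (- s + e).
Proof.
move=> /= a01 b01; set q := \prod_(i < r) _.
set s := \sum_(i < r) (_ - _) / _; set e := \sum_(i < r) (_ + _) / _.
have pos x : 0 < x <= 1 -> 0 < sin x / x.
  by move=> x01; rewrite (lt_le_trans (expR_gt0 _) (sinc_ge_expR x01)).
rewrite /q /s /e -!sumrN -!big_split/= !expR_sum; apply/andP; split.
  apply: ler_prod => i _; rewrite expR_ge0/= ler_pdivlMr ?pos//.
  have /andP[a0 _] := a01 i; have /andP[b0 _] := b01 i.
  apply: le_trans (sinc_ge_expR (a01 i)).
  rewrite (le_trans (ler_wpM2l (expR_ge0 _) (sinc_le_expR b0)))// -expRD ler_expR.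
  lra.
apply: ler_prod => i _; apply/andP; split.
  by rewrite divr_ge0// ltW// pos.
rewrite ler_pdivrMr ?pos//.
have /andP[a0 _] := a01 i.
rewrite (le_trans (sinc_le_expR a0))//.
rewrite (le_trans _ (ler_wpM2l (expR_ge0 _) (sinc_ge_expR (b01 i))))// -expRD ler_expR.
lra.
Qed.
End SineEstimates.

(** * Asymptotics *)

Section QCatalanAsymptotics.
Context {R : realType}.
Implicit Types t u v : R.
Variable m : nat.
Hypothesis m2 : (2 <= m)%N.

Let m0 : (0 < m)%N. Proof. exact: ltnW. Qed.

Local Notation C n := (qCatalan R n m).
Local Notation N r := ((m - 1) * r.+1)%N.

Lemma horner_qCatalan1 r :
  (C r.+1).[1] = \prod_(i < r) ((N r + i.+2)%:R / i.+2%:R).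
Proof.
have := congr1 (fun p : {poly R} => p.[1]) (qCatalan_prod R r m0).
rewrite hornerM !horner_prod.
under [in LHS]eq_bigr do rewrite horner_qint1.
under [in RHS]eq_bigr do rewrite horner_qint1.
rewrite prodf_div => <-; rewrite mulfK//.
by apply/prodf_neq0 => i _; rewrite pnatr_eq0.
Qed.

Lemma leq_qCatalan_arg r (i : 'I_r) : (N r + i.+2 <= m * r.+1)%N.
Proof.
rewrite mulnBl mul1n -leq_subRL ?leq_subr// ?subKn ?leq_pmull//.
by rewrite ltnS ltn_ord.
Qed.

(** Since m >= 2 gives (m-1)n >= n, each of the r summands is at least n^2/12, and r >= n/2. For r =
    0 the variance is 0. *)
Lemma pvar_qCatalan_ge r : (0 < r)%N -> r.+1%:R ^+ 3 / 24 <= pvar (C r.+1).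
Proof.
move=> r0; rewrite pvar_qCatalan//.
apply: (@le_trans _ _ (\sum_(i < r) r.+1%:R ^+ 2 / 12)).
  rewrite sumr_const card_ord -[_ *+ r]mulr_natr -(addn1 r) natrD.
  have : (1 : R) <= r%:R by rewrite ler1n.
  move: (r%:R : R) => x x1.
  rewrite -subr_ge0 (_ : _ - _ = (x + 1) ^+ 2 * (x - 1) / 24); last by field.
  by rewrite divr_ge0// mulr_ge0 ?sqr_ge0// subr_ge0.
apply: ler_sum => i _; rewrite ler_pM2r ?invr_gt0// natrD.
have : (r.+1%:R : R) <= (N r)%:R by rewrite ler_nat leq_pmull// subn_gt0.
have : (0 : R) <= r.+1%:R by [].
have : (0 : R) <= i.+2%:R by [].
move: (r.+1%:R : R) (i.+2%:R : R) ((N r)%:R : R) => x y z y0 x0 xz.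
rewrite (_ : _ - _ = z ^+ 2 + 2 * (z * y)); last by ring.
have z0 : 0 <= z by exact: le_trans xz.
rewrite (@le_trans _ _ (z ^+ 2))// ?lerXn2r ?nnegrE//.
by rewrite lerDl !mulr_ge0.
Qed.

(** Dividing by the value at 1 turns the quotients of sines into quotients of sin x / x; the bound
    on [t] keeps every x in ]0, 1]. *)
Lemma trig_sum_qCatalan_normalized r t v : 0 < t -> (m * r.+1)%:R * t <= 2 ->
  exists Q : R, [/\
    trig_sum (C r.+1) t (v - pmean (C r.+1) * t) / (C r.+1).[1] = Q * cos v,
    expR (- (t ^+ 2 / 2 * pvar (C r.+1)) - r.+1%:R * ((m * r.+1)%:R * t) ^+ 4) <= Q &
    Q <= expR (- (t ^+ 2 / 2 * pvar (C r.+1)) + r.+1%:R * ((m * r.+1)%:R * t) ^+ 4)].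
Proof.
move=> t0 Mt2.
pose a (i : 'I_r) := (N r + i.+2)%:R * t / 2.
pose b (i : 'I_r) := i.+2%:R * t / 2.
have a0 i : 0 < a i by rewrite !mulr_gt0// ltr0n addnS.
have b0 i : 0 < b i by rewrite !mulr_gt0.
have le2 k : (k <= m * r.+1)%N -> k%:R * t / 2 <= (m * r.+1)%:R * t / 2.
  by move=> km; rewrite !ler_pM2r// ler_nat.
have aM i : a i <= (m * r.+1)%:R * t / 2 by apply: le2; exact: leq_qCatalan_arg.
have bM i : b i <= (m * r.+1)%:R * t / 2.
  by apply: le2; rewrite (leq_trans _ (leq_qCatalan_arg i))// leq_addl.
have M1 : (m * r.+1)%:R * t / 2 <= 1 by rewrite ler_pdivrMr// mul1r.
have a01 i : 0 < a i <= 1 by rewrite a0 (le_trans (aM i)).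
have b01 i : 0 < b i <= 1 by rewrite b0 (le_trans (bM i)).
have sin0 (x : R) : 0 < x <= 1 -> 0 < sin x.
  move=> /andP[x0 x1]; rewrite sin_gt0_pi// x0 (le_lt_trans x1)//.
  by rewrite (lt_le_trans _ (@pi_ge2 R))// ltr1n.
have := prod_sinc_ratio_bounds a01 b01; set Q := \prod_(i < r) _.
set s := \sum_(i < r) (_ - _) / _; set e := \sum_(i < r) (_ + _) / _ => /= Qb.
(* The second-order terms add up to exactly the variance term. *)
have sE : s = t ^+ 2 / 2 * pvar (C r.+1).
  rewrite pvar_qCatalan// mulr_sumr; apply: eq_bigr => i _.
  by rewrite /a /b; field.
have ee : e <= r.+1%:R * ((m * r.+1)%:R * t) ^+ 4.
  apply: (@le_trans _ _ (\sum_(i < r) ((m * r.+1)%:R * t) ^+ 4)); last first.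
    rewrite sumr_const card_ord -[X in X <= _]mulr_natl ler_wpM2r ?exprn_even_ge0// ler_nat//.
  apply: ler_sum => i _.
  have a4 : a i ^+ 4 <= ((m * r.+1)%:R * t / 2) ^+ 4.
    by rewrite lerXn2r ?nnegrE// ltW// (lt_le_trans (a0 i)).
  have b4 : b i ^+ 4 <= ((m * r.+1)%:R * t / 2) ^+ 4.
    by rewrite lerXn2r ?nnegrE// ltW// (lt_le_trans (b0 i)).
  have : 0 <= ((m * r.+1)%:R * t) ^+ 4 by rewrite exprn_even_ge0.
  move: a4 b4; rewrite [(_ * t / 2) ^+ 4]exprMn exprVn -(natrX _ 2 4).
  by move: (a i ^+ 4) (b i ^+ 4) (((m * r.+1)%:R * t) ^+ 4) => x y z; lra.
exists Q; split.
- rewrite trig_sum_qCatalan//; last by move=> i; rewrite gt_eqF// sin0//; exact: b01.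
  rewrite addrC subrK horner_qCatalan1 mulrAC; congr (_ * _).
  rewrite -prodf_div; apply: eq_bigr => i _; rewrite /a /b.
  have : sin (i.+2%:R * t / 2) != 0 by rewrite gt_eqF// sin0//; exact: b01.
  have : (N r + i.+2)%:R != 0 :> R by rewrite pnatr_eq0 addnS.
  have : i.+2%:R != 0 :> R by [].
  move: (sin (i.+2%:R * t / 2)) (sin ((N r + i.+2)%:R * t / 2)).
  move: ((N r + i.+2)%:R : R) (i.+2%:R : R) => k l x y l0 k0 x0.
  by field; rewrite x0 l0 k0 gt_eqF.
- by case/andP: Qb => Qb _; rewrite (le_trans _ Qb)// ler_expR sE lerD2l lerN2.
- by case/andP: Qb => _ Qb; rewrite (le_trans Qb)// ler_expR sE lerD2l.
Qed.

Lemma cvg_trig_sum_qCatalan u v :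
  trig_sum (C n) (u / Num.sqrt (pvar (C n)))
    (v - pmean (C n) * (u / Num.sqrt (pvar (C n)))) / (C n).[1]
  @[n --> \oo] --> expR (- (u ^+ 2 / 2)) * cos v.
Proof.
have trig_sumN p t v' : trig_sum p (- t) (- v') = trig_sum p t v' :> R.
  by apply: eq_bigr => k _; rewrite mulrN -opprD cosN.
(* Cosine is even, so (u, v) may be negated; u = 0 is treated apart because the sine estimates need
   t > 0. *)
wlog : u v / 0 <= u => [H|u0].
  have [u0|u0] := leP 0 u; first exact: H.
  have Nu0 : 0 <= - u by rewrite oppr_ge0 ltW.
  have := H (- u) (- v) Nu0; rewrite sqrrN cosN; apply: cvg_trans.
  apply: near_eq_cvg; apply: nearW => n /=.
  by rewrite mulNr mulrN -opprD trig_sumN.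
rewrite -cvg_shiftS.
move: u0; rewrite le_eqVlt => /orP[/eqP <-|u0].
  rewrite expr0n/= mul0r oppr0 expR0 mul1r.
  apply: cvg_near_cst; apply: nearW => n /=.
  rewrite !mul0r mulr0 subr0 /trig_sum.
  under eq_bigr => k _ do rewrite mulr0 add0r.
  by rewrite -mulr_suml -horner1_sum mulrC mulKf// (qCatalan1_neq0 n).
(* The variance bound gives (m n t)^2 <= 24 m^2 u^2 / n, so the error n (m n t)^4 is at most 24^2
   m^4 u^4 / n. *)
pose K := 576 * m%:R ^+ 4 * u ^+ 4.
pose lo n := expR (- (u ^+ 2 / 2) - K * harmonic n).
pose hi n := expR (- (u ^+ 2 / 2) + K * harmonic n).
have cK : K * harmonic n @[n --> \oo] --> (0 : R).
  by rewrite -[X in _ --> X](mulr0 K); apply: cvgM; [exact: cvg_cst|exact: cvg_harmonic].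
have cvg_expR (w : nat -> R) a : w n @[n --> \oo] --> a ->
    expR (w n) @[n --> \oo] --> expR a.
  by move=> wa; apply: (cvg_comp w expR wa); exact: continuous_expR.
have clo : lo n @[n --> \oo] --> expR (- (u ^+ 2 / 2)).
  apply: cvg_expR.
  rewrite -[X in _ --> X]subr0; apply: cvgB => //; exact: cvg_cst.
have chi : hi n @[n --> \oo] --> expR (- (u ^+ 2 / 2)).
  apply: cvg_expR.
  rewrite -[X in _ --> X]addr0; apply: cvgD => //; exact: cvg_cst.
have main : \forall r \near \oo, exists Q : R, [/\
    trig_sum (C r.+1) (u / Num.sqrt (pvar (C r.+1)))
    (v - pmean (C r.+1) * (u / Num.sqrt (pvar (C r.+1)))) / (C r.+1).[1] = Q * cos v,
    lo r <= Q & Q <= hi r].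
  near=> r.
  have r0 : (0 < r)%N by near: r; exists 1%N.
  pose V := pvar (C r.+1).
  have rn : 0 < r.+1%:R :> R by [].
  have V24 : r.+1%:R ^+ 3 / 24 <= V := pvar_qCatalan_ge r0.
  have V0 : 0 < V by rewrite (lt_le_trans _ V24)// divr_gt0// exprn_gt0.
  pose t := u / Num.sqrt V.
  have t0 : 0 < t by rewrite divr_gt0// sqrtr_gt0.
  have t2 : t ^+ 2 = u ^+ 2 / V by rewrite exprMn exprVn sqr_sqrtr// ltW.
  have Mt2 : ((m * r.+1)%:R * t) ^+ 2 <= 24 * m%:R ^+ 2 * u ^+ 2 / r.+1%:R.
    rewrite exprMn t2 natrM.
    rewrite (_ : 24 * _ * _ / _ = (m%:R * r.+1%:R) ^+ 2 * (u ^+ 2 / (r.+1%:R ^+ 3 / 24))).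
      by rewrite !ler_wpM2l ?sqr_ge0// lef_pV2// posrE divr_gt0// exprn_gt0.
    by move: (r.+1%:R : R) rn => x x0; field; rewrite gt_eqF.
  have Mt0 : 0 <= (m * r.+1)%:R * t by rewrite mulr_ge0// ltW.
  have Mt : (m * r.+1)%:R * t <= 2.
    rewrite -ler_sqr ?nnegrE// (le_trans Mt2)// ler_pdivrMr//.
    have : 6 * m%:R ^+ 2 * u ^+ 2 <= r.+1%:R.
      near: r; exists (Num.truncn (6 * m%:R ^+ 2 * u ^+ 2)) => // n /= Kn.
      by rewrite ltW// (lt_le_trans (truncnS_gt _))// ler_nat ltnS.
    rewrite (_ : 24 * _ * _ = 2 ^+ 2 * (6 * m%:R ^+ 2 * u ^+ 2)); last by ring.
    by rewrite ler_pM2l// exprn_gt0.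
  have [Q [QE Qlo Qhi]] := trig_sum_qCatalan_normalized v t0 Mt.
  have Mt4 : r.+1%:R * ((m * r.+1)%:R * t) ^+ 4 <= K * harmonic r.
    rewrite (_ : 4%N = (2 * 2)%N)// exprM.
    apply: (@le_trans _ _ (r.+1%:R * (24 * m%:R ^+ 2 * u ^+ 2 / r.+1%:R) ^+ 2)).
      rewrite ler_pM2l// lerXn2r ?nnegrE ?sqr_ge0//.
      by rewrite divr_ge0// mulr_ge0 ?sqr_ge0// mulr_ge0 ?sqr_ge0.
    rewrite /K /harmonic /=; move: (r.+1%:R : R) rn => x x0.
    by rewrite le_eqVlt; apply/orP; left; apply/eqP; field; rewrite gt_eqF.
  have tV : t ^+ 2 / 2 * V = u ^+ 2 / 2 by rewrite t2; field; rewrite gt_eqF.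
  exists Q; split => //.
  - by rewrite (le_trans _ Qlo)// ler_expR tV lerD2l lerN2.
  - by rewrite (le_trans Qhi)// ler_expR tV lerD2l.
apply/cvgrPdist_le => e e0.
have /cvgrPdist_le/(_ _ e0) hlo := clo.
have /cvgrPdist_le/(_ _ e0) hhi := chi.
near=> n.
rewrite /=; have [Q [-> Q1 Q2]] : exists Q : R, [/\
    trig_sum (C n.+1) (u / Num.sqrt (pvar (C n.+1)))
    (v - pmean (C n.+1) * (u / Num.sqrt (pvar (C n.+1)))) / (C n.+1).[1] = Q * cos v,
    lo n <= Q & Q <= hi n] by near: n.
rewrite -mulrBl normrM (@le_trans _ _ (`|expR (- (u ^+ 2 / 2)) - Q|))//.
  by rewrite ler_piMr// cos_max.
have : `|expR (- (u ^+ 2 / 2)) - lo n| <= e by near: n.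
have : `|expR (- (u ^+ 2 / 2)) - hi n| <= e by near: n.
move: Q1 Q2; rewrite !ler_norml.
by move: (lo n) (hi n) (expR _) => x y z; lra.
Unshelve. all: by end_near. Qed.
End QCatalanAsymptotics.

(** * Laws on the natural numbers *)

Section DiscreteLaw.
Context {R : realType} {d : measure_display} {T : measurableType d}.
Variables (P : probability T R) (xi : {RV P >-> R}) (p : {poly R}).
Hypothesis p1 : p.[1] != 0.
Hypothesis pmfE : forall k : nat, pmf xi k%:R = p`_k / p.[1].

Let E (k : nat) : set T := xi @^-1` [set k%:R].

Let mE k : measurable (E k).
Proof. exact: measurable_sfunP. Qed.

Let PE k : P (E k) = (p`_k / p.[1])%:E.
Proof. by rewrite -pmfE fineK// fin_num_measure. Qed.

(** The prescribed masses already sum to 1, so [xi] almost surely takes one of these values and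
    expectations become finite sums. *)
Let PU : P (\big[setU/set0]_(k < size p) E k) = 1%E.
Proof.
rewrite measure_bigsetU//; last first.
  apply/trivIsetP => i j _ _ ij; apply/seteqP; split => // w.
  rewrite /E => -[] /= -> /eqP.
  by rewrite eqr_nat; apply/negP.
rewrite (eq_bigr (fun k : 'I_(size p) => (p`_k / p.[1])%:E)) => [|k _]; last exact: PE.
by rewrite sumEFin -mulr_suml -horner1_sum divff.
Qed.

Lemma integral_discrete (f : R -> R) : measurable_fun setT f ->
  (\int[P]_w (f (xi w))%:E = (\sum_(k < size p) f k%:R * (p`_k / p.[1]))%:E)%E.
Proof.
move=> mf.
have mU : measurable (\big[setU/set0]_(k < size p) E k) by exact: bigsetU_measurable.
rewrite (@ae_eq_integral _ _ _ P setT
    (fun w => \sum_(k < size p) (f k%:R)%:E * (\1_(E k) w)%:E)%E)//.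
- rewrite integral_sum//; last first.
    move=> k; apply: integrableZl => //.
    exact: integrable_indic_probability.
  rewrite -sumEFin; apply: eq_bigr => k _.
  rewrite integralZl//; last exact: integrable_indic_probability.
  by rewrite integral_indic// setIT EFinM -PE.
- by apply/measurable_EFinP; exact: measurableT_comp.
- apply: emeasurable_sum => k; apply: emeasurable_funM => //.
  by apply/measurable_EFinP; exact: measurable_indic.
- exists (~` \big[setU/set0]_(k < size p) E k); split.
  + exact: measurableC.
  + transitivity (1 - P (\big[setU/set0]_(k < size p) E k))%E.
      exact: probability_setC.
    by rewrite PU subee.
  + move=> w /= /not_implyP[_ fw]; apply: contra_not fw.
    rewrite -bigcup_mkord => -[k /= kp Ek].
    rewrite (bigD1 (Ordinal kp))//= big1 ?adde0.
      by rewrite indicE mem_set// mule1 Ek.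
    move=> j jk; rewrite indicE memNset ?mule0// /E /= Ek => /eqP.
    rewrite eqr_nat => /eqP kj; move/negP: jk; apply.
    by apply/eqP/val_inj.
Qed.

Lemma Rintegral_cos_discrete (u v : R) :
  \int[P]_w cos (u * xi w + v) = trig_sum p u v / p.[1].
Proof.
rewrite /Rintegral (@integral_discrete (fun x => cos (u * x + v)))/=.
  rewrite /trig_sum mulr_suml; apply: eq_bigr => k _.
  by rewrite mulrCA mulrA [k%:R * u]mulrC.
apply: continuous_measurable_fun => y; apply: continuous_comp; last exact: continuous_cos.
by apply: cvgD; [apply: cvgM => //; exact: cvg_cst|exact: cvg_cst].
Qed.

Lemma expectation_discrete : ('E_P[xi] = (pmean p)%:E)%E.
Proof.
rewrite unlock (@integral_discrete idfun); last exact: measurable_id.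
congr EFin.
rewrite /pmean -derivn1 horner_derivn1_sum mulr_suml; apply: eq_bigr => k _.
by rewrite ffactn1; ring.
Qed.

Lemma variance_discrete : ('V_P[xi] = (pvar p)%:E)%E.
Proof.
rewrite /variance unlock expectation_discrete /= [in LHS]unlock.
rewrite (@integral_discrete (fun x => (x - pmean p) * (x - pmean p))); last first.
  by apply: measurable_funM; apply: measurable_funB.
congr EFin; set c := pmean p.
(* (k - c)^2 = k (k - 1) + (1 - 2 c) k + c^2 expresses the variance by factorial moments, which are
   derivatives at 1. *)
transitivity (\sum_(k < size p) ((p`_k * (k ^_ 2)%:R) / p.[1]
    + (1 - 2 * c) * (p`_k * (k ^_ 1)%:R / p.[1]) + c ^+ 2 * (p`_k / p.[1]))).
  apply: eq_bigr => k _; rewrite ffactn1.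
  have -> : (k ^_ 2)%:R = k%:R * (k%:R - 1) :> R.
    by case: (k : nat) => [|n]; rewrite ?mul0r// ffactnS ffactn1/= natrM -natr1 addrK.
  by ring.
rewrite !big_split/= -!mulr_sumr -!mulr_suml -!horner_derivn1_sum -horner1_sum divff//.
by rewrite /pvar derivn1 -/(pmean p) -/c; ring.
Qed.
End DiscreteLaw.

Theorem corollary3p4 (R : realType) (m : nat) (hm : (2 <= m)%N)
    (d : nat -> measure_display) (Omega : forall n, measurableType (d n))
    (P : forall n, probability (Omega n) R)
    (xi : forall n, {RV (P n) >-> R})
    (hxi : forall n k : nat, (1 <= n)%N ->
      pmf (xi n) k%:R =
        (qCatalan R n m)`_k / \sum_(j < size (qCatalan R n m)) (qCatalan R n m)`_j) :
  cvg_in_distribution P (fun n => standardize (xi n)) (normal_prob (0 : R) (1 : R)).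
Proof.
have C1 r : (qCatalan R r.+1 m).[1] != 0 by exact/qCatalan1_neq0/ltnW.
have pmfE r k : pmf (xi r.+1) k%:R = (qCatalan R r.+1 m)`_k / (qCatalan R r.+1 m).[1].
  by rewrite horner1_sum hxi.
have EE r : fine 'E_(P r.+1)[xi r.+1] = pmean (qCatalan R r.+1 m).
  by rewrite (expectation_discrete (C1 r) (pmfE r)).
have VE r : 'V_(P r.+1)[xi r.+1] = (pvar (qCatalan R r.+1 m))%:E.
  by rewrite (variance_discrete (C1 r) (pmfE r)).
apply: cvg_in_distribution_cos => [u v|eps eps0].
- have cosE n : (0 < n)%N ->
      trig_sum (qCatalan R n m) (u / Num.sqrt (pvar (qCatalan R n m)))
        (v - pmean (qCatalan R n m) * (u / Num.sqrt (pvar (qCatalan R n m))))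
        / (qCatalan R n m).[1] =
      \int[P n]_w cos (u * standardize (xi n) w + v).
    case: n => // r _; rewrite -(Rintegral_cos_discrete (C1 r) (pmfE r)).
    (* Centering goes into the phase and scaling into the frequency. *)
    apply: eq_Rintegral => w _; rewrite /standardize EE VE/=; congr cos.
    by ring.
  rewrite normal_prob_cos.
  apply: cvg_trans (@cvg_trig_sum_qCatalan R m hm u v).
  by apply: near_eq_cvg; exists 1%N => // n /=; exact: cosE.
(* Chebyshev bounds the tail by 1 / (1 + x)^2 with x = 1 / eps, and (1 + x)^2 >= x. The index starts
   at 2 because the variance is 0 at n = 1. *)
- exists (1 + eps^-1); exists 2%N => // -[|r]//=; rewrite ltnS => r0.
  pose s := Num.sqrt (pvar (qCatalan R r.+1 m)).
  have V0 : 0 < pvar (qCatalan R r.+1 m).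
    by apply: lt_le_trans (pvar_qCatalan_ge hm r0); rewrite divr_gt0// exprn_gt0.
  have s0 : 0 < s by rewrite sqrtr_gt0.
  have A0 : 0 < 1 + eps^-1 by rewrite addr_gt0// invr_gt0.
  have As0 : 0 < (1 + eps^-1) * s by rewrite mulr_gt0.
  rewrite -lee_fin fineK ?fin_num_measure//; last exact: measurable_tail.
  apply: (@le_trans _ _ (P r.+1 [set w |
      (1 + eps^-1) * s <= `|xi r.+1 w - fine 'E_(P r.+1)[xi r.+1]|])).
    apply: le_measure; rewrite ?inE//; first exact: measurable_tail.
      rewrite (_ : [set w | _] = (fun w => `|xi r.+1 w - fine 'E_(P r.+1)[xi r.+1]|)
          @^-1` `[(1 + eps^-1) * s, +oo[%classic); last first.
        by apply/seteqP; split => w /=; rewrite in_itv/= andbT.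
      rewrite -[X in measurable X]setTI.
      have mX : measurable_fun setT (fun w => `|xi r.+1 w - fine 'E_(P r.+1)[xi r.+1]|).
        by apply: measurableT_comp => //; exact: measurable_funB.
      exact: mX.
    move=> w /=; rewrite /standardize VE /= normrM [ `|_^-1| ]gtr0_norm ?invr_gt0//.
    by rewrite ltr_pdivlMr// => /ltW.
  apply: le_trans (chebyshev _ As0) _.
  rewrite VE -EFinM lee_fin exprMn sqr_sqrtr; last exact: ltW.
  rewrite invfM mulfVK ?gt_eqF// -[leRHS]invrK lef_pV2 ?posrE ?exprn_gt0 ?invr_gt0//.
  have : 0 < eps^-1 by rewrite invr_gt0.
  by move: (eps^-1) => x x0; rewrite sqrrD expr1n mul1r; have := sqr_ge0 x; lra.
Qed.
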